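(* Let $n\ge 1$ and let $(\mathcal{M}_a,\omega_a)$, $a=1,2$, be locally homogeneous $n$-plectic manifolds with associated Lie $n$-algebras $(L(\mathcal{M}_a,\omega_a),\{l^a_k\})$. Let $\phi: L(\mathcal{M}_2,\omega_2)\to L(\mathcal{M}_1,\omega_1)$ be a strict $L_\infty$-isomorphism whose component in every degree $i=1-n,\dots,0$ is $$\phi_i=F^{\ast}: L^{i}(\mathcal{M}_2,\omega_2)\to L^{i}(\mathcal{M}_1,\omega_1),$$ where $F:\mathcal{M}_1\to\mathcal{M}_2$ is a diffeomorphism. Then $F$ is a multisymplectic diffeomorphism, that is, $F^{\ast}\omega_2=\omega_1$.
   Context: All manifolds are real and smooth. An $n$-plectic (multisymplectic) manifold $(\mathcal{M},\omega)$ is a manifold with a closed $(n+1)$-form $\omega$ which is non-degenerate: for all $p\in\mathcal{M}$ and $u\in T_p\mathcal{M}$, $\iota_u\omega=0$ implies $u=0$. An $(n-1)$-form $\beta$ is Hamiltonian if there is a vector field $u_\beta$ (necessarily unique, the Hamiltonian vector field of $\beta$) with $d\beta=-\iota_{u_\beta}\omega$. $\Omega^{n-1}_{\mathrm{Ham}}(\mathcal{M})$ is the space of Hamiltonian $(n-1)$-forms. Lie $n$-algebra $L(\mathcal{M},\omega)$: the graded vector space with $L^0=\Omega^{n-1}_{\mathrm{Ham}}(\mathcal{M})$, $L^{i}=\Omega^{n-1+i}(\mathcal{M})$ for $1-n\le i<0$, and zero otherwise, with graded skew-symmetric maps $l_k:L^{\otimes k}\to L$ of degree $2-k$: $l_1(\beta)=d\beta$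 if $|\beta|<0$ and $l_1=0$ on $L^0$; for $k\ge2$, $l_k(\beta_1,\dots,\beta_k)=\xi(k)\,\iota(u_{\beta_1}\wedge\cdots\wedge u_{\beta_k})\omega$ if all $\beta_i$ have degree $0$, and $l_k(\beta_1,\dots,\beta_k)=0$ if $\sum_i|\beta_i|<0$. Here $\xi(k)=-(-1)^{k(k+1)/2}$ and $\iota(u_1\wedge\cdots\wedge u_k)=\iota_{u_k}\cdots\iota_{u_1}$. A strict $L_\infty$-morphism is a degree-zero linear map $\phi$ with $l_k\circ\phi^{\otimes k}=\phi\circ l_k$ for all $k\ge1$; it is a strict $L_\infty$-isomorphism if it is moreover bijective. Local homogeneity: let $m=\dim\mathcal{M}$, $p\in\mathcal{M}$ and $K\subset\mathcal{M}$ compact with $p$ in its interior. A local Liouville (Euler-like) vector field at $p$ with respect to $K$ is a vector field $\Delta^p$ on $\mathcal{M}$ with $\operatorname{supp}\Delta^p\subset K$ for which there is a diffeomorphism $\varphi$ from the interior of $\operatorname{supp}\Delta^p$ to $\mathbb{R}^m$ with $\varphi_\ast\Delta^p=\sum_i x^i\partial/\partial x^i$. A form $\omega$ is locally homogeneous at $p$ if for every open $U\ni p$ there is a local Liouville vector field $\Delta^p$ at $p$ with respect to a compact set $K\subset U$ such that $\mathcal{L}_{\Delta^p}\omega=f\omega$ for some $f\in C^\infty(\mathcal{M})$. $\omega$ (and $(\mathcal{M},\omega)$) is locally homogeneous if this holds at every $p\in\mathcal{M}$. *)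

(* Defs.v *)
From HB Require Import structures.
From mathcomp Require Import all_boot all_order all_algebra.
From mathcomp Require Import all_classical all_reals all_analysis.

Set Implicit Arguments.
Unset Strict Implicit.
Unset Printing Implicit Defensive.

Import Order.TTheory GRing.Theory Num.Theory.
Import numFieldNormedType.Exports.

Local Open Scope classical_set_scope.
Local Open Scope ring_scope.

(* [U] is meant to be open: then these depend on [f] only through its
   restriction to [U]. *)
Fixpoint Ck (R : realType) (V W : normedModType R) (k : nat) (U : set V)
    (f : V -> W) : Prop :=
  match k with
  | 0 => forall x, U x -> {for x, continuous f}
  | k'.+1 => (forall x, U x -> differentiable f x) /\
             forall v : V, Ck k' U (fun x => 'D_v f x)
  end.

Definition smooth (R : realType) (V W : normedModType R) (U : set V)
  (f : V -> W) : Prop := forall k, Ck k U f.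

(* An [m]-dimensional real smooth manifold, presented by an atlas containing a
   preferred chart [chart p] around every point [p].  [chart p] is a
   homeomorphism from [chart_dom p] onto [chart p @` chart_dom p], with inverse
   [param p]; the values of [chart p] and [param p] elsewhere are irrelevant. *)
Record manifold (R : realType) (m : nat) := Manifold {
  carrier :> topologicalType;
  manifold_hausdorff : hausdorff_space carrier;
  manifold_second_countable : @second_countable carrier;
  chart_dom : carrier -> set carrier;
  chart : carrier -> carrier -> 'rV[R]_m;
  param : carrier -> 'rV[R]_m -> carrier;
  chart_dom_open : forall p, open (chart_dom p);
  chart_dom_mem : forall p, chart_dom p p;
  chart_im_open : forall p, open (chart p @` chart_dom p);
  chartK : forall p q, chart_dom p q -> param p (chart p q) = q;
  chart_continuous : forall p q, chart_dom p q -> {for q, continuous (chart p)};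
  param_continuous : forall p y,
    (chart p @` chart_dom p) y -> {for y, continuous (param p)};
  transition_smooth : forall p q,
    smooth [set y | (chart p @` chart_dom p) y /\ chart_dom q (param p y)]
           (chart q \o param p)
}.

Section Manifold.
Context {R : realType} {m : nat} {M : manifold R m}.

Definition chart_im (p : M) : set 'rV[R]_m := chart p @` chart_dom p.

(* The tangent space at [p] is ['rV[R]_m], a tangent vector being given by its
   components in the preferred chart at [p].  The next two definitions are the
   differentials of [f : M -> W] and [g : W -> M] in these terms. *)
Definition diff_out (W : normedModType R) (f : M -> W) (p : M)
  (v : 'rV[R]_m) : W := 'd (f \o param p) (chart p p) v.

Definition diff_in (W : normedModType R) (g : W -> M) (y : W) (v : W)
  : 'rV[R]_m := 'd (chart (g y) \o g) y v.

(* [A] is meant to be open. *)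
Definition smooth_out (W : normedModType R) (A : set M) (f : M -> W) : Prop :=
  forall p, smooth [set y | chart_im p y /\ A (param p y)] (f \o param p).

Definition smooth_in (W : normedModType R) (g : W -> M) : Prop :=
  continuous g /\
  forall q, smooth [set y | chart_dom q (g y)] (chart q \o g).

Definition vfield : Type := M -> 'rV[R]_m.

(* The components of [X] in the chart at [p]: a function on [chart_im p]. *)
Definition vf_loc (p : M) (X : vfield) (y : 'rV[R]_m) : 'rV[R]_m :=
  diff_out (chart p) (param p y) (X (param p y)).

Definition smooth_vf (X : vfield) : Prop :=
  forall p, smooth (chart_im p) (vf_loc p X).

Definition supp (X : vfield) : set M := closure [set p | X p != 0].

(* Forms of all degrees live in the single vector space [diff_form]: a [k]-form
   takes a point [p] and the list [[:: v_1; ...; v_k]] of its arguments in the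
   tangent space at [p], and vanishes on lists whose length is not [k]. *)
Definition diff_form : Type := M -> seq 'rV[R]_m -> R.

(* The form [a] in the chart at [p], as a form on [chart_im p]. *)
Definition form_loc (p : M) (a : diff_form) (y : 'rV[R]_m)
  (s : seq 'rV[R]_m) : R :=
  a (param p y) [seq diff_in (param p) y v | v <- s].

Definition is_form (k : nat) (a : diff_form) : Prop :=
  [/\ forall p s, size s != k -> a p s = 0,
      forall p s t c u v,
        a p (s ++ (c *: u + v) :: t) = c * a p (s ++ u :: t) + a p (s ++ v :: t),
      forall p s t r v, a p (s ++ v :: t ++ v :: r) = 0
    & forall p s, smooth (chart_im p) (fun y => form_loc p a y s)].

(* d a (v_0, ..., v_k) = \sum_i (-1)^i v_i (a (v_0, ..., ^v_i, ..., v_k)), with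
   the v_j extended to constant vector fields in the chart at p. *)
Definition ext_deriv (a : diff_form) : diff_form := fun p s =>
  \sum_(i < size s) (-1) ^+ i *
    'D_(nth 0 s i) (fun y => form_loc p a y (take i s ++ drop i.+1 s))
                   (chart p p).

Definition interior_prod (X : vfield) (a : diff_form) : diff_form :=
  fun p s => a p (X p :: s).

(* Cartan's formula. *)
Definition lie_deriv (X : vfield) (a : diff_form) : diff_form :=
  ext_deriv (interior_prod X a) + interior_prod X (ext_deriv a).

Definition form_scale (f : M -> R) (a : diff_form) : diff_form :=
  fun p s => f p * a p s.

Definition nondegenerate (w : diff_form) : Prop :=
  forall (p : M) (u : 'rV[R]_m), (forall s, w p (u :: s) = 0) -> u = 0.

Definition n_plectic (n : nat) (w : diff_form) : Prop :=
  [/\ is_form n.+1 w, ext_deriv w = 0 & nondegenerate w].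

Definition is_ham_vf (w b : diff_form) (u : vfield) : Prop :=
  smooth_vf u /\ ext_deriv b = - interior_prod u w.

Definition hamiltonian (n : nat) (w b : diff_form) : Prop :=
  is_form n.-1 b /\ exists u, is_ham_vf w b u.

(* Unique when it exists, by non-degeneracy of [w]; 0 otherwise. *)
Definition ham_vf (w b : diff_form) : vfield :=
  xget (fun=> 0) [set u : M -> 'rV[R]_m | is_ham_vf w b u].

Definition local_liouville (p : M) (K : set M) (D : vfield) : Prop :=
  [/\ compact K, interior K p, smooth_vf D, supp D `<=` K
    & exists (phi : M -> 'rV[R]_m) (psi : 'rV[R]_m -> M),
        [/\ forall q, interior (supp D) q -> psi (phi q) = q,
            forall x, interior (supp D) (psi x) /\ phi (psi x) = x,
            smooth_out (interior (supp D)) phi,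
            smooth_in psi
          & (* phi_* D is the Euler field x |-> x *)
            forall q, interior (supp D) q -> diff_out phi q (D q) = phi q]].

Definition locally_homogeneous_at (w : diff_form) (p : M) : Prop :=
  forall U : set M, open U -> U p ->
    exists (K : set M) (D : vfield) (f : M -> R),
      [/\ K `<=` U, local_liouville p K D, smooth_out setT f
        & lie_deriv D w = form_scale f w].

Definition locally_homogeneous (w : diff_form) : Prop :=
  forall p, locally_homogeneous_at w p.

End Manifold.

Arguments vfield {R m} M.
Arguments diff_form {R m} M.

Section Maps.
Context {R : realType} {m1 m2 : nat} {M1 : manifold R m1} {M2 : manifold R m2}.

Definition smooth_map (F : M1 -> M2) : Prop :=
  continuous F /\
  forall p q, smooth [set y | chart_im p y /\ chart_dom q (F (param p y))]
                     (chart q \o F \o param p).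

Definition pushforward (F : M1 -> M2) (p : M1) (v : 'rV[R]_m1) : 'rV[R]_m2 :=
  diff_out (chart (F p) \o F) p v.

Definition pullback (F : M1 -> M2) (a : diff_form M2) : diff_form M1 :=
  fun p s => a (F p) [seq pushforward F p v | v <- s].

End Maps.

Definition diffeomorphism (R : realType) (m1 m2 : nat) (M1 : manifold R m1)
    (M2 : manifold R m2) (F : M1 -> M2) : Prop :=
  smooth_map F /\
  exists G : M2 -> M1, [/\ smooth_map G, cancel F G & cancel G F].

(* A graded vector space with multibrackets.  The component of degree [i] is a
   subspace [Lcomp i] of an ambient space [Lamb]; the bracket l_k is given on a
   list of [k] homogeneous elements, each paired with its degree. *)
Record multibracket_space (R : realType) := MultibracketSpace {
  Lamb : lmodType R;
  Lcomp : int -> set Lamb;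
  Lbracket : seq (int * Lamb) -> Lamb
}.

Arguments Lcomp {R} m i _.
Arguments Lbracket {R} m x.

Section Morphisms.
Context {R : realType}.

Definition homogeneous (L : multibracket_space R) (x : seq (int * Lamb L)) :=
  forall b, b \in x -> Lcomp L b.1 b.2.

Definition strict_morphism (L L' : multibracket_space R)
    (phi : int -> Lamb L -> Lamb L') : Prop :=
  [/\ forall i x, Lcomp L i x -> Lcomp L' i (phi i x),
      forall i (c : R) x y, Lcomp L i x -> Lcomp L i y ->
        phi i (c *: x + y) = c *: phi i x + phi i y
    & forall x : seq (int * Lamb L), (0 < size x)%N -> homogeneous x ->
        Lbracket L' [seq (b.1, phi b.1 b.2) | b <- x] =
        phi (\sum_(b <- x) b.1 + 2 - (size x)%:Z) (Lbracket L x)].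

Definition strict_isomorphism (L L' : multibracket_space R)
    (phi : int -> Lamb L -> Lamb L') : Prop :=
  strict_morphism phi /\ forall i, set_bij (Lcomp L i) (Lcomp L' i) (phi i).

End Morphisms.

Section LieAlgebra.
Context {R : realType} {m : nat} {M : manifold R m}.

Definition ham_comp (n : nat) (w : diff_form M) (i : int)
  : set (diff_form M) :=
  if i == 0 then [set b | hamiltonian n w b]
  else if (1 - n%:Z <= i) && (i < 0) then
    [set b | is_form (absz (n%:Z - 1 + i)) b]
  else [set 0].

Definition xi (k : nat) : R := - (-1) ^+ (k * k.+1)./2.

(* Only lists of elements of degree <= 0 matter: for these the sum of the
   degrees is negative exactly when not all of them are 0. *)
Definition ham_bracket (w : diff_form M) (x : seq (int * diff_form M))
  : diff_form M :=
  match x with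
  | [::] => 0
  | [:: b] => if b.1 < 0 then ext_deriv b.2 else 0
  | _ => if all (fun b => b.1 == 0) x then
           xi (size x) *:
             foldl (fun a u => interior_prod u a) w [seq ham_vf w b.2 | b <- x]
         else 0
  end.

Definition lie_n_algebra (n : nat) (w : diff_form M) : multibracket_space R :=
  MultibracketSpace (ham_comp n w) (ham_bracket w).

End LieAlgebra.

(* Main.v *)
Require Import Defs.
From mathcomp Require Import all_boot all_order all_algebra.
From mathcomp Require Import all_classical all_reals all_analysis.
From mathcomp Require Import ring.

(* Local homogeneity forces the dimension to be n+1.  In a Liouville chart, let E
   be the Euler field; closedness turns L_E w = f w into the ray equation
   D_y w + (n+1) w = f w, so f = n+1 at the centre and components vanishing at the
   centre vanish along rays.  If w(x, e_1, ..., e_n) vanished for all n-element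
   parts of some e with w(e) <> 0 at the centre and some x <> 0, then dw = 0 makes
   w(e) constant on the ray through x, so f = n+1 on this ray; but f = 0 outside
   the support of the Liouville field, a contradiction at a cluster point of the
   ray on the boundary of the (compact) support.

   Hence w is a volume form and every (n-1)-form is Hamiltonian.  As f is a bump
   function, the Hamiltonian vector fields span the tangent space at the (dense)
   centres c.  There, F^* d = d F^* gives w1(u', s) = w2(u, F_* s), and the binary
   bracket gives w1(u1', u2', s) = w2(u1, u2, F_* s), where u and u' are the vector
   fields of b and of F^* b.  Non-degeneracy yields F_* u2' = u2, thus F^* w2 = w1
   at c, and everywhere by continuity. *)

Set Implicit Arguments.
Unset Strict Implicit.
Unset Printing Implicit Defensive.

Import Order.TTheory GRing.Theory Num.Theory.
Import numFieldNormedType.Exports.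

Local Open Scope classical_set_scope.
Local Open Scope ring_scope.

(** The ray equation is singular at the centre: [t g' = k g] with [g 0 = 0] has the solution
    [g t = t] when [k = 1], so a zero at the centre need not propagate. Here it does, because
    [k = f - (n+1)] vanishes at the centre as well. For a general multisymplectic form, few forms
    are Hamiltonian, and cut-offs destroy the property. In top degree, [d b = - iota_u w] is a
    linear system for [u], solved pointwise by Cramer's rule, so cut-off forms and brackets are
    Hamiltonian. The latter matters because in degree 0 [phi] is known to be the pullback only on
    Hamiltonian forms. The identity for [d] alone relates two a priori unrelated vectors [u] and
    [u']. Inserting [u'] into the identity for another form [b1] gives
    [w1(u1', u', t) = w2(u1, F_* u', F_* t)], and the bracket evaluates the same number as
    [w2(u1, u, F_* t)]; their difference isolates [F_* u' - u]. Tangent vectors are components in a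
    chart that changes with the point, so nothing is differentiated before being moved to a fixed
    chart, or pulled back to an open subset of a vector space. *)

(** * Alternating multilinear functions of lists of vectors *)

Section Alternating.
Context {R : comNzRingType} {V : lmodType R}.
Implicit Types (b : seq V -> R) (s t e : seq V) (u v : V).

(** These are the pointwise clauses of [is_form], on a single tangent space. *)
Definition alternating (k : nat) b : Prop :=
  [/\ forall s, size s != k -> b s = 0,
      forall s t c u v, b (s ++ (c *: u + v) :: t) = c * b (s ++ u :: t) + b (s ++ v :: t)
    & forall s t r v, b (s ++ v :: t ++ v :: r) = 0].

Section Theory.
Context {k : nat} {b : seq V -> R} (hb : alternating k b).

Lemma alt_size s : size s != k -> b s = 0. Proof. by have [h _ _] := hb; exact: h. Qed.

Lemma alt_lin s t c u v :
  b (s ++ (c *: u + v) :: t) = c * b (s ++ u :: t) + b (s ++ v :: t).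
Proof. by have [_ h _] := hb; exact: h. Qed.

Lemma alt_rep s t r v : b (s ++ v :: t ++ v :: r) = 0.
Proof. by have [_ _ h] := hb; exact: h. Qed.

Lemma altD s t u v : b (s ++ (u + v) :: t) = b (s ++ u :: t) + b (s ++ v :: t).
Proof. by have := alt_lin s t 1 u v; rewrite scale1r mul1r. Qed.

Lemma alt0 s t : b (s ++ 0 :: t) = 0.
Proof.
have := altD s t 0 0; rewrite addr0 => /eqP.
by rewrite addrC -subr_eq subrr eq_sym => /eqP.
Qed.

Lemma altZ s t c u : b (s ++ c *: u :: t) = c * b (s ++ u :: t).
Proof. by rewrite -[c *: u]addr0 alt_lin alt0 addr0. Qed.

Lemma alt_sum (I : Type) (r : seq I) (P : pred I) (G : I -> V) s t :
  b (s ++ (\sum_(i <- r | P i) G i) :: t) = \sum_(i <- r | P i) b (s ++ G i :: t).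
Proof.
elim/big_rec2: _ => [|i x y _ IH]; first exact: alt0.
by rewrite altD IH.
Qed.

Lemma alt_swap s t u v : b (s ++ u :: v :: t) = - b (s ++ v :: u :: t).
Proof.
have := alt_rep s [::] t (u + v); rewrite /= altD.
have e1 x y z : s ++ x :: y :: z = rcons s x ++ y :: z by rewrite cat_rcons.
rewrite 2!(e1 _ (u + v)) !altD -!e1.
rewrite (alt_rep s [::] t u) (alt_rep s [::] t v) add0r addr0.
by move/eqP; rewrite addr_eq0 => /eqP.
Qed.

Lemma alt_move s t v : b (s ++ v :: t) = (-1) ^+ size s * b (v :: s ++ t).
Proof.
elim/last_ind: s t => [|s x IH] t; first by rewrite expr0 mul1r.
rewrite size_rcons exprS -mulrA !cat_rcons alt_swap IH.
by rewrite mulN1r.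
Qed.

Lemma alt_dup s v : v \in s -> b (v :: s) = 0.
Proof. by case/splitPr => p1 p2; exact: (alt_rep [::] p1 p2 v). Qed.

End Theory.

Lemma alt_cons k b v : alternating k.+1 b -> alternating k (fun s => b (v :: s)).
Proof.
move=> [h1 h2 h3]; split.
- by move=> s h; apply: h1; rewrite /= eqSS.
- by move=> s t c u w; exact: (h2 (v :: s)).
- by move=> s t r w; exact: (h3 (v :: s)).
Qed.

Lemma alt_cons0 b v : alternating 0 b -> forall s, b (v :: s) = 0.
Proof. by move=> h s; exact: (alt_size h). Qed.

Fixpoint spanned e v : Prop :=
  if e is x :: e' then exists c u, spanned e' u /\ v = c *: x + u else v = 0.

(** Multilinearity expands every argument along [e]; sorting, and dropping lists with repetitions,
    leaves the subsequences of [e]. The induction peels off the head of [e]. *)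
Lemma alt_span_eq0 e k b : alternating k b ->
  (forall s, subseq s e -> size s = k -> b s = 0) ->
  forall s, (forall x, x \in s -> spanned e x) -> b s = 0.
Proof.
elim: e k b => [|e0 e IH] k b hb hs.
  case=> [_|x s /(_ x (mem_head _ _)) /= ->]; last exact: (alt0 hb [::]).
  by case: k hb hs => [hb h|k hb _]; [apply: h|apply: (alt_size hb)].
(* A repeated [e0] gives 0; a single one is moved to the front and frozen there, which lowers the
   degree. *)
have A t : (forall x, x \in t -> x = e0 \/ spanned e x) -> b t = 0.
  move=> ht; case: (boolP (e0 \in t)) => [|e0t]; last first.
    apply: (IH k b) => // [s se|x xt].
      by apply: hs; exact: (subseq_trans se (subseq_cons _ _)).
    by case: (ht x xt) => // xe; rewrite xe (negbTE e0t) in xt.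
  move=> e0t; case: (splitPr e0t) ht => p1 p2 ht.
  rewrite (alt_move hb); case: (boolP (e0 \in p1 ++ p2)) => e0p.
    by rewrite (alt_dup hb e0p) mulr0.
  suff -> : b (e0 :: p1 ++ p2) = 0 by rewrite mulr0.
  case: k hb hs => [hb _|k hb hs]; first exact: alt_cons0.
  apply: (IH k (fun s => b (e0 :: s))); first exact: alt_cons.
    by move=> s se ss; apply: hs; [rewrite /= eqxx|rewrite /= ss].
  move=> x xp; have : x \in p1 ++ e0 :: p2.
    by move: xp; rewrite !mem_cat inE => /orP[->//|->]; rewrite !orbT.
  by move=> /ht[xe|//]; rewrite xe (negbTE e0p) in xp.
(* [pre] holds the arguments already split along [e0] and the tail. *)
suff B s pre : (forall x, x \in pre -> x = e0 \/ spanned e x) ->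
    (forall x, x \in s -> spanned (e0 :: e) x) -> b (pre ++ s) = 0.
  by move=> s; exact: (B s [::]).
elim: s pre => [|x s IHs] pre hp hx; first by rewrite cats0; exact: A.
have [c [u [ue ->]]] := hx x (mem_head _ _).
have hp' y : y = e0 \/ spanned e y -> forall z, z \in rcons pre y -> z = e0 \/ spanned e z.
  by move=> ? z; rewrite mem_rcons inE => /orP[/eqP -> //|/hp].
have hs' y : y \in s -> spanned (e0 :: e) y by move=> ys; apply: hx; rewrite inE ys orbT.
rewrite (alt_lin hb) -!cat_rcons (IHs (rcons pre e0)); last exact: hs'; last by apply: hp'; left.
rewrite (IHs (rcons pre u)); last exact: hs'; last by apply: hp'; right.
by rewrite mulr0 addr0.
Qed.

Lemma subseq_drop1 s e : subseq s e -> size e = (size s).+1 ->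
  exists p x r, e = p ++ x :: r /\ s = p ++ r.
Proof.
elim: e s => [//|y e IH] [|z s] /=.
  by move=> _ [/size0nil ->]; exists [::], y, [::].
case: eqP => [-> se [ee]|_ se [ee]].
  by have [p [x [r [-> ->]]]] := IH s se ee; exists (y :: p), x, r.
exists [::], y, e; split=> //=; apply/eqP.
by have [_ <-] := size_subseq_leqif se; rewrite ee.
Qed.

End Alternating.

(** * Signed sums over the deletion of one entry of a list *)

Section AlternatingSum.
Context {V : eqType} {W : zmodType}.
Implicit Types (q : V -> seq V -> W) (s t : seq V).

(* [\sum_i (-1) ^+ i q s_i (s without s_i)] *)
Fixpoint asum q s : W :=
  if s is v :: s' then q v s' - asum (fun u t => q u (v :: t)) s' else 0.

Lemma eq_asum q q' s :
  (forall u t, u \in s -> size s = (size t).+1 -> q u t = q' u t) ->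
  asum q s = asum q' s.
Proof.
elim: s q q' => //= v s IH q q' h; rewrite h ?mem_head//; congr (_ - _).
by apply: IH => u t us st; apply: h; rewrite /= ?st// inE us orbT.
Qed.

Lemma asum_eq0 q s :
  (forall u t, subseq t s -> size s = (size t).+1 -> q u t = 0) -> asum q s = 0.
Proof.
elim: s q => //= v s IH q h; have -> : q v s = 0 by apply: h => //; exact: subseq_cons.
rewrite (IH (fun u t => q u (v :: t))) ?subr0// => u t ts st.
by apply: h; rewrite /= ?eqxx// st.
Qed.

Lemma asumD q q' s : asum (fun u t => q u t + q' u t) s = asum q s + asum q' s.
Proof.
by elim: s q q' => [|v s IH] q q' /=; rewrite ?addr0// IH opprD addrACA.
Qed.

Lemma asum_zero s : asum (fun _ _ => 0) s = 0.
Proof. by elim: s => //= v s ->; rewrite subr0. Qed.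

Lemma asumN q s : asum (fun u t => - q u t) s = - asum q s.
Proof. by elim: s q => [|v s IH] q /=; rewrite ?oppr0// IH opprD. Qed.

Lemma asum_only q p x r :
  (forall u t, u \in p ++ r -> x \in t -> q u t = 0) ->
  asum q (p ++ x :: r) = (if odd (size p) then - q x (p ++ r) else q x (p ++ r)).
Proof.
elim: p q => [|y p IH] q h /=.
  rewrite (@eq_asum _ (fun _ _ => 0)) ?asum_zero ?subr0// => u t ur _.
  by rewrite h ?mem_head.
rewrite h ?mem_head//; last by rewrite mem_cat mem_head orbT.
rewrite IH => [|u t ur xt]; first by case: ifP; rewrite sub0r ?opprK.
by rewrite h// inE ?ur ?xt orbT.
Qed.

(** [c i] stands for multiplication by [(-1) ^+ i], left abstract because [W] is only an additive
    group. *)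
Lemma asum_bigE q s x0 (c : nat -> W -> W) :
  (forall w, c 0%N w = w) -> (forall i w, c i.+1 w = - c i w) ->
  \sum_(i < size s) c i (q (nth x0 s i) (take i s ++ drop i.+1 s)) = asum q s.
Proof.
move=> c0 cS; elim: s q => [|v s IH] q; first by rewrite big_ord0.
rewrite big_ord_recl /= c0 drop0; congr (_ + _).
rewrite -IH -sumrN; apply: eq_bigr => i _.
by rewrite /= /bump add1n cS.
Qed.

End AlternatingSum.

Lemma raddf_asum (V : eqType) (W W' : zmodType)
    (f : W -> W') (q : V -> seq V -> W) s : {morph f : x y / x - y} ->
  f (asum q s) = asum (fun u t => f (q u t)) s.
Proof.
move=> fB; elim: s q => [|v s IH] q /=; last by rewrite fB IH.
by rewrite -(subrr 0) fB subrr.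
Qed.

Section AlternatingAsum.
Context {R : comNzRingType} {V : lmodType R}.
Implicit Types (b : seq V -> R) (q : V -> seq V -> R) (s t e : seq V) (u v : V).

Lemma asumZ q s c : asum (fun u t => c * q u t) s = c * asum q s.
Proof. by elim: s q => [|v s IH] q /=; rewrite ?mulr0// IH mulrBr. Qed.

(** Moving the deleted entry back to its place turns every term into [b s]. This is the source of
    the factor [n+1] in the Euler equation, and of [n] in the exterior derivative of the forms that
    span. *)
Lemma asum_cons k b s : alternating k b ->
  asum (fun u t => b (u :: t)) s = (size s)%:R * b s.
Proof.
elim: s k b => [|v s IH] k b hb /=; first by rewrite mul0r.
case: k hb => [hb|k hb].
  rewrite (alt_cons0 _ hb) mulr0 (@eq_asum _ _ _ (fun _ _ => 0)) ?asum_zero ?subr0//.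
  by move=> *; exact: alt_cons0 hb _.
rewrite (@eq_asum _ _ _ (fun u t => -1 * b (v :: u :: t))) => [|u t _ _].
  by rewrite asumZ (IH _ _ (alt_cons v hb)) mulN1r opprK -natr1 mulrDl mul1r addrC.
by rewrite (alt_swap hb [::]) mulN1r.
Qed.

(* The value at the arguments [map G s] of the derivation sending [G v] to [H v]. *)
Fixpoint deriv_args (I : Type) (G H : I -> V) b (s : seq I) : R :=
  if s is i :: s' then
    b (H i :: map G s') + deriv_args G H (fun t => b (G i :: t)) s'
  else 0.

Lemma deriv_args_eq0 (I : Type) (G H : I -> V) b (s : seq I) : (forall t, b t = 0) ->
  deriv_args G H b s = 0.
Proof. by elim: s b => //= v s IH b hb; rewrite hb IH ?addr0. Qed.

Lemma deriv_argsE (I : eqType) (G H : I -> V) k b (s : seq I) : alternating k b ->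
  deriv_args G H b s = asum (fun i r => b (H i :: map G r)) s.
Proof.
elim: s k b => //= v s IH k b hb; congr (_ + _).
case: k hb => [hb|k hb].
  rewrite deriv_args_eq0; last exact: alt_cons0 hb.
  rewrite (@eq_asum _ _ _ (fun _ _ => 0)) ?asum_zero ?oppr0//.
  by move=> u t _ _; exact: alt_cons0 hb _.
rewrite (IH _ _ (alt_cons _ hb)) -asumN; apply: eq_asum => u t _ _.
by rewrite (alt_swap hb [::]).
Qed.

(* This is [d o d = 0] at the level of second-order terms. *)
Lemma asum_deriv_args (I : eqType) (G : I -> V) (H : I -> I -> V) k b (s : seq I) :
  alternating k b -> (forall i j, H i j = H j i) ->
  asum (fun i r => deriv_args G (H i) b r) s = 0.
Proof.
move=> hb HC; elim: s k b hb => //= v s IH k b hb.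
rewrite asumD; case: k hb => [hb|k hb].
  have z u t : b (u :: t) = 0 by exact: alt_cons0 hb _.
  have dz i w r : deriv_args G (H i) (fun r => b (w :: r)) r = 0.
    by rewrite deriv_args_eq0.
  rewrite (deriv_argsE _ _ _ hb) !(eq_asum (q' := fun _ _ => 0) (fun _ _ _ _ => z _ _)).
  by rewrite (eq_asum (q' := fun _ _ => 0) (fun _ _ _ _ => dz _ _ _)) asum_zero addr0 subr0.
rewrite (IH _ _ (alt_cons _ hb)) addr0 (deriv_argsE _ _ _ hb).
rewrite -(@eq_asum _ _ (fun i r => b (H v i :: map G r))) ?subrr//.
by move=> u t _ _; rewrite HC.
Qed.

(** The degree is existential because each step of the recursion freezes one argument and lowers it;
    degree 0 is kept, everything being 0 there. *)
Lemma asum_lin q s t c u v :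
  (forall x, exists k, alternating k (q x)) ->
  (forall c u v t, q (c *: u + v) t = c * q u t + q v t) ->
  asum q (s ++ (c *: u + v) :: t) =
  c * asum q (s ++ u :: t) + asum q (s ++ v :: t).
Proof.
elim: s q => [|x s IH] q hq ql /=; last first.
  have [k hk] := hq x; rewrite (alt_lin hk).
  rewrite IH; first by ring.
    move=> y; have [[|l] hl] := hq y; last by exists l; exact: alt_cons.
    exists 0%N; split => *; rewrite !(alt_cons0 _ hl)// ?mulr0 ?addr0//.
  by move=> *; exact: ql.
rewrite ql.
suff -> : asum (fun w t => q w (c *: u + v :: t)) t =
    asum (fun w t => c * q w (u :: t) + q w (v :: t)) t.
  by rewrite asumD asumZ; ring.
by apply: eq_asum => w r _ _; have [k hk] := hq w; rewrite (alt_lin hk [::]).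
Qed.

(** Only the two terms that delete one of the copies of [v] survive; moving the other copy into the
    same place costs the sign that makes them cancel. *)
Lemma asum_rep q s t r v :
  (forall x, exists k, alternating k (q x)) ->
  asum q (s ++ v :: t ++ v :: r) = 0.
Proof.
elim: s q => [|x s IH] q hq /=; last first.
  have [k hk] := hq x; rewrite (alt_rep hk) IH ?subr0//.
  move=> y; have [[|l] hl] := hq y; last by exists l; exact: alt_cons.
  exists 0%N; split => *; rewrite !(alt_cons0 _ hl)// ?mulr0 ?addr0//.
rewrite (@asum_only _ _ (fun u t => q u (v :: t))) => [|u w _ vw].
  have [k hk] := hq v; rewrite (alt_move hk) -signr_odd.
  by case: odd; rewrite ?expr1 ?expr0 ?mulN1r ?mul1r ?subrr// opprK addNr.
by have [k hk] := hq u; exact: (alt_dup hk).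
Qed.

Lemma asum_size k q s : (forall x, alternating k (q x)) -> size s != k.+1 ->
  asum q s = 0.
Proof.
case: s => // v s hq; rewrite /= eqSS => ks.
rewrite (alt_size (hq v))// (@eq_asum _ _ _ (fun _ _ => 0)) ?asum_zero ?subr0//.
by move=> u t _ st; rewrite (alt_size (hq u))//= -st.
Qed.

Lemma alternating_asum k q :
  (forall x, alternating k (q x)) ->
  (forall c u v t, q (c *: u + v) t = c * q u t + q v t) ->
  alternating k.+1 (asum q).
Proof.
move=> hq ql; split => *; first exact: (asum_size hq).
- by apply: asum_lin => // x; exists k.
- by apply: asum_rep => x; exists k.
Qed.

End AlternatingAsum.

(** * Solving a linear system given by an alternating function, and dimension counts *)

Section TopDegree.
Context {R : fieldType} {V : lmodType R}.
Implicit Types (w a : seq V -> R) (s e : seq V).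

Lemma top_neq0 n w e : alternating n w -> (forall v, spanned e v) -> size e = n ->
  (exists s, w s != 0) -> w e != 0.
Proof.
move=> hw he en [s]; apply: contra => /eqP we; apply/eqP.
apply: (alt_span_eq0 hw _ (fun x _ => he x)) => t te tn.
have [_] := size_subseq_leqif te; rewrite tn en eqxx => /esym/eqP -> //.
Qed.

(** Cramer's rule for the equation [a = - w(u, _)] in the unknown [u]. *)
Definition top_solve w a e : V := asum (fun u t => - (a t / w e) *: u) e.

(** The terms at entries of [s] repeat an argument, so only the entry of [e] missing from [s]
    contributes. Nothing is assumed about the span of [e], which allows an application before the
    dimension is known. *)
Lemma top_solve_subseq n w a e s : alternating n.+1 w -> size e = n.+1 ->
  w e != 0 -> subseq s e -> size s = n -> w (top_solve w a e :: s) = - a s.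
Proof.
move=> hw en we se sn; have [|p [x [r [ee es]]]] := subseq_drop1 se; first by rewrite en sn.
rewrite /top_solve (@raddf_asum _ _ _ (fun v => w (v :: s))); last first.
  by move=> x1 x2; rewrite (altD hw [::]) -scaleN1r (altZ hw [::]) mulN1r.
rewrite [X in asum _ X]ee asum_only => [|v t]; last first.
  by rewrite -es => vs _; rewrite (altZ hw [::]) (alt_dup hw vs) mulr0.
rewrite -es !(altZ hw [::]).
have we' : w e = (-1) ^+ size p * w (x :: s) by rewrite ee (alt_move hw) es.
have wx : w (x :: s) != 0 by apply: contra we; rewrite we' => /eqP ->; rewrite mulr0.
by rewrite we' -signr_odd; case: odd; rewrite ?expr1 ?expr0; field; rewrite wx ?oppr_eq0 ?oner_eq0.
Qed.

Lemma top_solveP n w a e s : alternating n.+1 w -> alternating n a ->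
  (forall v, spanned e v) -> size e = n.+1 -> w e != 0 ->
  a s = - w (top_solve w a e :: s).
Proof.
move=> hw ha he en we; apply/eqP; rewrite -addr_eq0; apply/eqP.
set u := top_solve w a e.
apply: (@alt_span_eq0 _ _ e n (fun s => a s + w (u :: s)) _ _ s (fun x _ => he x)).
  have [a1 a2 a3] := ha; have [w1 w2 w3] := alt_cons u hw; split.
  - by move=> r ns; rewrite a1// w1// addr0.
  - by move=> r t c x y; rewrite a2 w2; ring.
  - by move=> *; rewrite a3 w3 addr0.
by move=> r re rn; rewrite (top_solve_subseq _ hw)// subrr.
Qed.

Lemma spanned_top_solve w a e : spanned e (top_solve w a e).
Proof.
have sN s (x : V) : spanned s x -> spanned s (- x).
  elim: s x => [|y s IH] x /=; first by move=> ->; rewrite oppr0.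
  by move=> [c [u [us ->]]]; exists (- c), (- u); rewrite opprD scaleNr; split=> //; exact: IH.
suff h (c : V -> seq V -> R) s : spanned s (asum (fun u t => c u t *: u) s) by exact: h.
elim: s c => //= v s IH c; exists (c v s), (- asum (fun u t => c u (v :: t) *: u) s).
by split=> //; apply: sN; exact: (IH (fun u t => c u (v :: t))).
Qed.

End TopDegree.

Section Dimension.
Context {R : fieldType} {m : nat}.

Definition std_basis : seq 'rV[R]_m := [seq delta_mx 0 i | i <- enum 'I_m].

Lemma size_std_basis : size std_basis = m.
Proof. by rewrite size_map size_enum_ord. Qed.

Lemma spanned_std_basis v : spanned std_basis v.
Proof.
rewrite (row_sum_delta v) -big_enum /std_basis; elim: (enum _) => [|i s IH] /=.
  by rewrite big_nil.
by rewrite big_cons; exists (v 0 i), (\sum_(j <- s) v 0 j *: delta_mx 0 j).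
Qed.

Lemma spanned_leq (e : seq 'rV[R]_m) : (forall v, spanned e v) -> (m <= size e)%N.
Proof.
move=> he; pose S := foldr (fun x (A : 'M[R]_m) => (x + A)%MS) 0 e.
have le_e : (\rank S <= size e)%N.
  rewrite /S; elim: e {he S} => [|x e IH] /=; first by rewrite mxrank0.
  by rewrite (leq_trans (mxrank_adds_leqif _ _))// -[leqRHS]add1n leq_add// ?rank_leq_row.
have vS v : spanned e v -> (v <= S)%MS.
  rewrite /S; elim: e v {he S le_e} => [v ->|x e IH v [c [u [ue ->]]]] /=.
    exact: sub0mx.
  by rewrite addmx_sub_adds// ?scalemx_sub// IH.
rewrite -{1}(mxrank1 R m) (leq_trans (mxrankS _) le_e)//.
by apply/row_subP => i; exact: vS.
Qed.

Lemma alternating_gt_dim k (b : seq 'rV[R]_m -> R) s : alternating k b ->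
  (m < k)%N -> b s = 0.
Proof.
move=> hb mk; apply: (alt_span_eq0 hb _ (fun x _ => spanned_std_basis x)) => t.
by move=> /size_subseq; rewrite size_std_basis => tm tk; move: mk; rewrite -tk ltnNge tm.
Qed.

End Dimension.

(** * Locality of derivatives and symmetry of second derivatives *)

Section Locality.
Context {R : realType} {V W : normedModType R}.

Lemma near_eq_diff (f g : V -> W) x : {near x, f =1 g} -> differentiable f x ->
  differentiable g x /\ 'd g x = 'd f x :> (V -> W).
Proof.
move=> fg /diff_locallyP[dc /eqaddoP hf].
have hg : g \o shift x = cst (g x) + 'd f x +o_ 0 id.
  apply/eqaddoP => e e0.
  have fg' : \forall h \near 0, f (h + x) = g (h + x).
    by near_simpl; move: fg; rewrite (near_shift 0)/= subr0.
  near=> h.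
  have -> : (g \o shift x - (cst (g x) + 'd f x)) h = (f \o shift x - (cst (f x) + 'd f x)) h.
    rewrite /GRing.add /= /GRing.opp /=.
    congr (_ - (_ + _)); last by rewrite /cst (nbhs_singleton fg).
    by apply/esym; near: h.
  by near: h; exact: hf.
have dg := diff_unique dc hg.
split; last exact: dg.
by apply/diff_locallyP; rewrite dg; split; [exact: dc|exact: hg].
Unshelve. all: by end_near. Qed.

Lemma near_eq_differentiable (f g : V -> W) x : {near x, f =1 g} ->
  differentiable f x -> differentiable g x.
Proof. by move=> fg /(near_eq_diff fg)[]. Qed.

Lemma open_near (U : set V) (f g : V -> W) x : open U -> U x ->
  (forall y, U y -> f y = g y) -> {near x, f =1 g}.
Proof. by move=> oU Ux fg; apply: filterS (open_nbhs_nbhs (conj oU Ux)). Qed.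

Lemma is_derive_line (f : V -> W) x u (t : R) : derivable f (x + t *: u) u ->
  is_derive t 1 (fun t => f (x + t *: u)) ('D_u f (x + t *: u)).
Proof.
have e : (fun h : R => h^-1 *: (f (x + (h *: 1 + t) *: u) - f (x + t *: u))) =
         (fun h => h^-1 *: (f (h *: u + (x + t *: u)) - f (x + t *: u))).
  by apply/funext => h; rewrite scalerDl [h *: 1]mulr1 addrCA.
by rewrite /derivable -e => fu; split; rewrite /derivable /derive //= e.
Qed.

End Locality.

Section Schwarz.
Context {R : realType} {V : normedModType R}.

(** The mean value theorem is applied twice: along [u] to the difference of [f] and its translate by
    [h *: v], then along [v] to ['D_u f]. *)
Lemma mean_value2 (f : V -> R) x u v (h : R) : 0 < h ->
  (forall a b, 0 <= a <= h -> 0 <= b <= h ->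
    derivable f (x + a *: u + b *: v) u /\
    derivable ('D_u f) (x + a *: u + b *: v) v) ->
  exists a b, [/\ 0 <= a <= h, 0 <= b <= h &
    f (x + h *: u + h *: v) - f (x + h *: u) - f (x + h *: v) + f x =
    h ^+ 2 * 'D_v ('D_u f) (x + a *: u + b *: v)].
Proof.
move=> h0 hf.
have hh : 0 <= h <= h by apply/andP; split=> //; exact: ltW.
have h00 : (0 : R) <= 0 <= h by apply/andP; split=> //; exact: ltW.
pose phi t := f (x + h *: v + t *: u) - f (x + t *: u).
pose dphi t := 'D_u f (x + h *: v + t *: u) - 'D_u f (x + t *: u).
have phiP t : 0 <= t <= h -> is_derive t 1 phi (dphi t).
  move=> th; apply: is_deriveB; apply: is_derive_line.
    rewrite addrAC; exact: (hf t h th hh).1.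
  have := (hf t 0 th h00).1; rewrite scale0r addr0; exact.
have [a ah] : exists2 a, a \in `[0, h] & phi h - phi 0 = dphi a * (h - 0).
  apply: MVT_segment; first exact: ltW.
    by move=> t; rewrite in_itv/= => /andP[t0 th]; apply: phiP; rewrite !ltW.
  apply: derivable_within_continuous => t; rewrite in_itv/= => /phiP[]//.
rewrite in_itv/= in ah; rewrite subr0 => phE.
pose psi t := 'D_u f (x + a *: u + t *: v).
have [b bh] : exists2 b, b \in `[0, h] &
    psi h - psi 0 = 'D_v ('D_u f) (x + a *: u + b *: v) * (h - 0).
  have psiP t : 0 <= t <= h -> is_derive t 1 psi ('D_v ('D_u f) (x + a *: u + t *: v)).
    by move=> th; apply: is_derive_line; have [] := hf a t ah th.
  apply: (MVT_segment (df := fun b => 'D_v ('D_u f) (x + a *: u + b *: v))); first exact: ltW.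
    by move=> t; rewrite in_itv/= => /andP[t0 th]; apply: psiP; rewrite !ltW.
  apply: derivable_within_continuous => t; rewrite in_itv/= => /psiP[]//.
rewrite in_itv/= in bh; rewrite subr0 => psE.
exists a, b; split=> //.
transitivity (phi h - phi 0).
  rewrite /phi scale0r !addr0 (addrAC x (h *: v)).
  by rewrite opprB addrA addrAC.
have -> : phi h - phi 0 = (psi h - psi 0) * h.
  by rewrite phE /psi /dphi scale0r addr0 (addrAC x (h *: v)).
by rewrite psE; ring.
Qed.

Lemma ball_near2 (g1 g2 : V -> R) U x (e : R) :
  {for x, continuous g1} -> {for x, continuous g2} -> open U -> U x -> 0 < e ->
  exists2 r : R, 0 < r & forall y, ball x r y ->
    [/\ U y, `|g1 x - g1 y| < e & `|g2 x - g2 y| < e].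
Proof.
move=> c1 c2 oU Ux e0.
have h1 : \forall y \near x, `|g1 x - g1 y| < e by move/cvgrPdist_lt : c1; apply.
have h2 : \forall y \near x, `|g2 x - g2 y| < e by move/cvgrPdist_lt : c2; apply.
have h3 : \forall y \near x, U y by exact: open_nbhs_nbhs.
have /nbhs_ballP[r r0 rP] : \forall y \near x,
    [/\ U y, `|g1 x - g1 y| < e & `|g2 x - g2 y| < e].
  by apply: filterS3 h3 h1 h2.
by exists r.
Qed.

(** The second difference is symmetric in [u] and [v], so some values of the two mixed derivatives
    near [x] coincide; continuity at [x] concludes. *)
Lemma derive_comm (f : V -> R) (U : set V) x u v : open U -> U x ->
  (forall w w', forall y, U y -> derivable f y w /\ derivable ('D_w f) y w') ->
  (forall w w', {for x, continuous ('D_w' ('D_w f))}) ->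
  'D_v ('D_u f) x = 'D_u ('D_v f) x.
Proof.
move=> oU Ux df cf; apply/eqP; rewrite -subr_eq0 -normr_le0.
apply/ler_addgt0Pr => e e0; rewrite add0r.
have e2 : 0 < e / 2 by rewrite divr_gt0.
have [r r0 rU] := ball_near2 (cf u v) (cf v u) oU Ux e2.
have [h h0 hr] : exists2 h : R, 0 < h & h * (`|u| + `|v|) < r.
  exists (r / (1 + (`|u| + `|v|))); first by rewrite divr_gt0// ltr_pwDl ?addr_ge0.
  by rewrite mulrAC ltr_pdivrMr ?ltr_pwDl ?addr_ge0// ltr_pM2l// ltrDr.
have inb a b w w' : `|w| + `|w'| = `|u| + `|v| -> 0 <= a <= h -> 0 <= b <= h ->
    ball x r (x + a *: w + b *: w').
  move=> ww /andP[a0 ah] /andP[b0 bh]; rewrite -ball_normE /= -addrA opprD addNKr normrN.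
  rewrite (le_lt_trans (ler_normD _ _))// !normrZ !ger0_norm// (le_lt_trans _ hr)//.
  by rewrite -ww mulrDr lerD// ler_wpM2r.
have D w w' : `|w| + `|w'| = `|u| + `|v| -> forall a b, 0 <= a <= h -> 0 <= b <= h ->
    derivable f (x + a *: w + b *: w') w /\
    derivable ('D_w f) (x + a *: w + b *: w') w'.
  by move=> ww a b ah bh; apply: df; have [] := rU _ (inb a b w w' ww ah bh).
have [a [b [ah bh E1]]] := mean_value2 h0 (D u v erefl).
have [a' [b' [ah' bh' E2]]] := mean_value2 h0 (D v u (addrC _ _)).
have [_ n1 _] := rU _ (inb _ _ u v erefl ah bh).
have [_ _ n2] := rU _ (inb _ _ v u (addrC _ _) ah' bh').
move: E1 E2 n1 n2; rewrite (addrAC x (h *: v)).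
move: ('D_v ('D_u f) (x + a *: u + b *: v)) ('D_u ('D_v f) (x + a' *: v + b' *: u)).
move: ('D_v ('D_u f) x) ('D_u ('D_v f) x).
move: (f (x + h *: u + h *: v)) (f (x + h *: u)) (f (x + h *: v)) (f x).
move=> f1 f2 f3 f4 C1 C2 A B E1 E2 nA nB.
have AB : A = B.
  have hh : h ^+ 2 != 0 by rewrite expf_neq0// gt_eqF.
  by apply: (mulfI hh); rewrite -E1 -E2; ring.
rewrite -(subrKA A) (le_trans (ler_normD _ _))//.
by rewrite (splitr e) lerD// ltW// AB distrC.
Qed.

End Schwarz.

(** * Closure properties of [Ck] and of smooth functions *)

Section CkClosure.
Context {R : realType} {V : normedModType R}.

Section Codomain.
Context {W : normedModType R}.
Implicit Types (U : set V) (f g : V -> W) (k : nat).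

Lemma Ck_eq k U f g : open U -> (forall x, U x -> f x = g x) ->
  Ck k U f -> Ck k U g.
Proof.
move=> oU; elim: k f g => [|k IH] f g fg /=.
  move=> h x Ux; have xfg := open_near oU Ux fg.
  change (g @ x --> g x); rewrite -(fg _ Ux).
  by apply: cvg_trans (h x Ux); exact: near_eq_cvg.
move=> [df h]; split=> [x Ux|v].
  by apply: near_eq_differentiable (df x Ux); exact: open_near Ux fg.
apply: (IH ('D_v f)) (h v) => x Ux.
by apply: near_eq_derive; exact: open_near Ux fg.
Qed.

Lemma Ck_sub k U U' f : U' `<=` U -> Ck k U f -> Ck k U' f.
Proof.
move=> UU; elim: k f => [|k IH] f /=; first by move=> h x /UU; exact: h.
by move=> [df h]; split=> [x /UU|v]; [exact: df|exact: IH].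
Qed.

Lemma CkW k U f : Ck k.+1 U f -> Ck k U f.
Proof.
elim: k f => [|k IH] f /= [df h].
  by move=> x Ux; apply: differentiable_continuous; exact: df.
by split=> // v; exact: IH (h v).
Qed.

Lemma Ck_local k U f : (forall x, U x -> exists2 U', U' x & Ck k U' f) -> Ck k U f.
Proof.
elim: k f => [|k IH] f /= h; first by move=> x /h[U' U'x]; exact.
split=> [x /h[U' U'x [df _]]|v]; first exact: df.
by apply: IH => x /h[U' U'x [_ df]]; exists U'.
Qed.

Lemma Ck_cst k U (w : W) : Ck k U (fun=> w).
Proof.
elim: k w => [|k IH] w /=; first by move=> *; exact: cvg_cst.
split=> // v; rewrite [X in Ck _ _ X](_ : _ = fun=> 0)//.
by apply/funext => x; exact: derive_cst.
Qed.

Lemma CkD k U f g : open U -> Ck k U f -> Ck k U g ->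
  Ck k U (fun x => f x + g x).
Proof.
move=> oU; elim: k f g => [|k IH] f g /=.
  by move=> hf hg x Ux; apply: cvgD; [exact: hf|exact: hg].
move=> [df hf] [dg hg]; split=> [x Ux|v].
  by apply: (differentiableD (df x Ux) (dg x Ux)).
apply: (Ck_eq oU _ (IH _ _ (hf v) (hg v))) => x Ux.
by rewrite -(deriveD (diff_derivable (df x Ux)) (diff_derivable (dg x Ux))).
Qed.

Lemma CkN k U f : open U -> Ck k U f -> Ck k U (fun x => - f x).
Proof.
move=> oU; elim: k f => [|k IH] f /=.
  by move=> hf x Ux; apply: cvgN; exact: hf.
move=> [df hf]; split=> [x Ux|v]; first exact: (differentiableN (df x Ux)).
apply: (Ck_eq oU _ (IH _ (hf v))) => x Ux.
by rewrite -(deriveN (diff_derivable (df x Ux))).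
Qed.

Lemma Ck_sum k U (I : Type) (r : seq I) (F : I -> V -> W) : open U ->
  (forall i, Ck k U (F i)) -> Ck k U (fun x => \sum_(i <- r) F i x).
Proof.
move=> oU h; elim: r => [|i r IH].
  by apply: (Ck_eq oU _ (Ck_cst k U 0)) => x _; rewrite big_nil.
by apply: (Ck_eq oU _ (CkD oU (h i) IH)) => x _; rewrite big_cons.
Qed.

End Codomain.

Lemma CkZl k U (a : V -> R) (W : normedModType R) (w : W) : open U -> Ck k U a ->
  Ck k U (fun x => a x *: w).
Proof.
move=> oU; elim: k a => [|k IH] a /=.
  by move=> ha x Ux; apply: cvgZr_tmp; exact: ha.
move=> [da ha]; split=> [x Ux|v]; first exact: (differentiableZl _ (da x Ux)).
apply: (Ck_eq oU _ (IH _ (ha v))) => x Ux.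
by rewrite (deriveE _ (differentiableZl w (da x Ux))) (diffZl _ (da x Ux))/= -deriveE//; exact: da.
Qed.

Lemma CkM k U (f g : V -> R) : open U -> Ck k U f -> Ck k U g ->
  Ck k U (fun x => f x * g x).
Proof.
move=> oU; elim: k f g => [|k IH] f g hf hg.
  by move=> x Ux; apply: cvgM; [exact: hf|exact: hg].
have hf1 := CkW hf; have hg1 := CkW hg; move: hf hg => /= [df hf] [dg hg].
split=> [x Ux|v]; first exact: (differentiableM (df x Ux) (dg x Ux)).
apply: (Ck_eq oU _ (CkD oU (IH _ _ hf1 (hg v)) (IH _ _ hg1 (hf v)))) => x Ux.
by rewrite (deriveM (diff_derivable (df x Ux)) (diff_derivable (dg x Ux))).
Qed.

Lemma CkV k U (f : V -> R) : open U -> (forall x, U x -> f x != 0) -> Ck k U f ->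
  Ck k U (fun x => (f x)^-1).
Proof.
move=> oU f0; elim: k => [|k IH].
  by move=> hf x Ux; apply: cvgV; [exact: f0|exact: hf].
move=> hf; have hV := IH (CkW hf); move: hf => /= [df hf].
split=> [x Ux|v]; first exact: (differentiableV (df x Ux) (f0 x Ux)).
apply: (Ck_eq oU _ (CkM oU (CkN oU (CkM oU hV hV)) (hf v))) => x Ux.
rewrite (deriveV (f0 x Ux) (diff_derivable (df x Ux))).
by rewrite -expr2 exprVn.
Qed.

Lemma Ck_coordP k U m (f : V -> 'rV[R]_m) : open U ->
  Ck k U f <-> forall i, Ck k U (fun x => f x 0 i).
Proof.
move=> oU; split=> [|h]; last first.
  apply: (Ck_eq oU _ (Ck_sum (index_enum 'I_m) oU (fun i => CkZl (delta_mx 0 i) oU (h i)))) => x Ux.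
  by rewrite -row_sum_delta.
elim: k f => [|k IH] f /=.
  move=> h i x Ux; exact: (@continuous_comp _ _ _ f (fun M : 'rV[R]_m => M 0 i) x (h x Ux)
    (@coord_continuous _ _ _ 0 i (f x))).
move=> [df h] i; split=> [x Ux|v].
  exact: (differentiable_comp (df x Ux) (differentiable_coord _ 0 i)).
apply: (Ck_eq oU _ (IH _ (h v) i)) => x Ux.
by rewrite (derive_mx (diff_derivable (df x Ux))) mxE.
Qed.

Lemma derive_comp m (W : normedModType R) (f : V -> 'rV[R]_m) (g : 'rV[R]_m -> W) x v :
  differentiable f x -> differentiable g (f x) ->
  'D_v (g \o f) x = 'D_('D_v f x) g (f x).
Proof.
move=> df dg; rewrite (deriveE _ (differentiable_comp df dg)) (deriveE _ dg).
by rewrite (deriveE _ df) (diff_comp df dg).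
Qed.

Lemma derive_sum_delta m (W : normedModType R) (g : 'rV[R]_m -> W) y v :
  differentiable g y ->
  'D_v g y = \sum_i v 0 i *: 'D_(delta_mx 0 i) g y.
Proof.
move=> dg; rewrite (deriveE _ dg) {1}(row_sum_delta v) linear_sum.
by apply: eq_bigr => i _; rewrite linearZ (deriveE _ dg).
Qed.

(** In coordinates, the chain rule writes the derivative as a finite sum of products whose factors
    are of class one lower. *)
Lemma Ck_comp k U m (U' : set 'rV[R]_m) (f : V -> 'rV[R]_m) (g : 'rV[R]_m -> R) :
  open U -> (forall x, U x -> U' (f x)) -> Ck k U f -> Ck k U' g -> Ck k U (g \o f).
Proof.
move=> oU UU; elim: k g => [|k IH] g hf.
  by move=> hg x Ux; exact: (@continuous_comp _ _ _ f g x (hf x Ux) (hg _ (UU x Ux))).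
have hf1 := CkW hf; move: hf => /= [df hf] [dg hg].
split=> [x Ux|v]; first exact: (differentiable_comp (df x Ux) (dg _ (UU x Ux))).
have h i : Ck k U (fun x => 'D_v f x 0 i * ('D_(delta_mx 0 i) g \o f) x).
  by apply: CkM => //; [exact: (Ck_coordP _ _ oU).1 (hf v) i|exact: IH].
apply: (Ck_eq oU _ (Ck_sum (index_enum 'I_m) oU h)) => x Ux.
rewrite (derive_comp _ (df x Ux) (dg _ (UU x Ux))).
by rewrite (derive_sum_delta _ (dg _ (UU x Ux))).
Qed.

End CkClosure.

Section SmoothClosure.
Context {R : realType} {V : normedModType R}.
Implicit Types (U : set V).

Section Codomain.
Context {W : normedModType R}.
Implicit Types (f g : V -> W).

Lemma smooth_eq U f g : open U -> (forall x, U x -> f x = g x) ->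
  smooth U f -> smooth U g.
Proof. by move=> oU fg h k; exact: Ck_eq (h k). Qed.

Lemma smooth_sub U U' f : U' `<=` U -> smooth U f -> smooth U' f.
Proof. by move=> UU h k; exact: Ck_sub UU (h k). Qed.

Lemma smooth_local U f : (forall x, U x -> exists2 U', U' x & smooth U' f) -> smooth U f.
Proof. by move=> h k; apply: Ck_local => x /h[U' U'x /(_ k)]; exists U'. Qed.

Lemma smooth_cst U (w : W) : smooth U (fun=> w).
Proof. by move=> k; exact: Ck_cst. Qed.

Lemma smoothD U f g : open U -> smooth U f -> smooth U g ->
  smooth U (fun x => f x + g x).
Proof. by move=> oU hf hg k; exact: CkD. Qed.

Lemma smoothN U f : open U -> smooth U f -> smooth U (fun x => - f x).
Proof. by move=> oU hf k; exact: CkN. Qed.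

Lemma smooth_sum U (I : Type) (r : seq I) (F : I -> V -> W) : open U ->
  (forall i, smooth U (F i)) -> smooth U (fun x => \sum_(i <- r) F i x).
Proof. by move=> oU hF k; apply: Ck_sum => // i; exact: hF. Qed.

Lemma smooth_derive U f v : smooth U f -> smooth U ('D_v f).
Proof. by move=> h k; have [_] := h k.+1; exact. Qed.

Lemma smooth_differentiable U f x : smooth U f -> U x -> differentiable f x.
Proof. by move=> h Ux; have [+ _] := h 1%N; exact. Qed.

Lemma smooth_derivable U f x v : smooth U f -> U x -> derivable f x v.
Proof. move=> h Ux; exact: diff_derivable (smooth_differentiable h Ux). Qed.

Lemma smooth_continuous U f x : smooth U f -> U x -> {for x, continuous f}.
Proof. by move=> h Ux; exact: h 0%N x Ux. Qed.

End Codomain.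

Lemma smoothZl U (a : V -> R) (W : normedModType R) (w : W) : open U ->
  smooth U a -> smooth U (fun x => a x *: w).
Proof. by move=> oU ha k; exact: CkZl. Qed.

Lemma smoothM U (f g : V -> R) : open U -> smooth U f -> smooth U g ->
  smooth U (fun x => f x * g x).
Proof. by move=> oU hf hg k; exact: CkM. Qed.

Lemma smoothV U (f : V -> R) : open U -> (forall x, U x -> f x != 0) ->
  smooth U f -> smooth U (fun x => (f x)^-1).
Proof. by move=> oU f0 hf k; exact: CkV. Qed.

Lemma smooth_coordP U m (f : V -> 'rV[R]_m) : open U ->
  smooth U f <-> forall i, smooth U (fun x => f x 0 i).
Proof.
move=> oU; split=> [h i k|h k]; first exact: (Ck_coordP k f oU).1.
by apply/(Ck_coordP k f oU) => i; exact: h.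
Qed.

Lemma smooth_comp U m (U' : set 'rV[R]_m) (f : V -> 'rV[R]_m) (g : 'rV[R]_m -> R) :
  open U -> (forall x, U x -> U' (f x)) -> smooth U f -> smooth U' g ->
  smooth U (g \o f).
Proof. by move=> oU UU hf hg k; exact: Ck_comp UU (hf k) (hg k). Qed.

Lemma smooth_id U : smooth U (@id V).
Proof.
case=> [|k] /=; first by move=> x _; exact: cvg_id.
split=> [x _|v]; first exact: ex_diff.
by rewrite [X in Ck _ _ X](_ : _ = fun=> v); [exact: Ck_cst|apply/funext => x; exact: derive_id].
Qed.

Lemma smooth_asum (W : normedModType R) U (I : eqType) (q : V -> I -> seq I -> W) s :
  open U ->
  (forall v t, smooth U (fun y => q y v t)) -> smooth U (fun y => asum (q y) s).
Proof.
move=> oU; elim: s q => [|v s IH] q h /=; first exact: smooth_cst.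
apply: smoothD => //; apply: smoothN => //.
by apply: (IH (fun y u t => q y u (v :: t))).
Qed.

Lemma derive_sumr (W : normedModType R) (I : Type) (r : seq I) (F : I -> V -> W) x v :
  (forall i, derivable (F i) x v) ->
  'D_v (fun y => \sum_(i <- r) F i y) x = \sum_(i <- r) 'D_v (F i) x.
Proof.
move=> h; suff : is_derive x v (fun y => \sum_(i <- r) F i y) (\sum_(i <- r) 'D_v (F i) x).
  by move=> [_ ->].
elim: r => [|i r IH].
  rewrite big_nil; have -> : (fun y => \sum_(i <- [::]) F i y) = cst 0.
    by apply/funext => y; rewrite big_nil.
  exact: is_derive_cst.
rewrite big_cons.
have -> : (fun y => \sum_(i <- i :: r) F i y) = F i + (fun y => \sum_(i <- r) F i y).
  by apply/funext => y; rewrite big_cons.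
exact: is_deriveD (derivableP (h i)) IH.
Qed.

Lemma derive_lin (W : normedModType R) (f : V -> W) x c u v : differentiable f x ->
  'D_(c *: u + v) f x = c *: 'D_u f x + 'D_v f x.
Proof. by move=> df; rewrite !(deriveE _ df) linearP. Qed.

Lemma derive_scalar_lin (f g h : V -> R) (U : set V) x c v : open U -> U x ->
  (forall y, U y -> h y = c * f y + g y) -> derivable f x v -> derivable g x v ->
  'D_v h x = c * 'D_v f x + 'D_v g x.
Proof.
move=> oU Ux hh df dg; rewrite (near_eq_derive _ (open_near oU Ux hh)).
rewrite (_ : (fun y => _) = c \*: f + g); last exact/funext.
by rewrite (deriveD (@derivableZ _ _ _ f c x v df) dg) (@deriveZ _ _ _ f c x v df).
Qed.

Lemma smooth_derive_comm m U (T : V -> 'rV[R]_m) x u v : open U -> smooth U T -> U x ->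
  'D_v ('D_u T) x = 'D_u ('D_v T) x.
Proof.
move=> oU hT Ux; apply/rowP => i.
have hTi : smooth U (fun y => T y 0 i) by exact: (smooth_coordP T oU).1 hT i.
have E w w' : ('D_w' ('D_w T) x) 0 i = 'D_w' ('D_w (fun y => T y 0 i)) x.
  rewrite (derive_mx (smooth_derivable (smooth_derive _ hT) Ux)) mxE.
  apply: near_eq_derive; apply: (open_near oU Ux) => y Uy.
  by rewrite (derive_mx (smooth_derivable hT Uy)) mxE.
refine (etrans (E u v) (etrans _ (esym (E v u)))).
refine (@derive_comm R V (fun y => T y 0 i) U x u v oU Ux _ _).
  move=> w w' y Uy; split; first exact (smooth_derivable hTi Uy).
  exact (smooth_derivable (smooth_derive w hTi) Uy).
move=> w w'; exact (smooth_continuous (smooth_derive w' (smooth_derive w hTi)) Ux).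
Qed.

End SmoothClosure.

Lemma asum_map (I J : eqType) (W : zmodType) (G : I -> J) (q : J -> seq J -> W) s :
  asum q (map G s) = asum (fun u t => q (G u) (map G t)) s.
Proof. by elim: s q => //= v s IH q; rewrite IH. Qed.

Lemma deriv_args_comb (R : comNzRingType) (V : lmodType R) (I J : Type) (G H : I -> V)
    (r : seq J) (c : J -> R) (b : J -> seq V -> R) s :
  deriv_args G H (fun t => \sum_(j <- r) c j * b j t) s =
  \sum_(j <- r) c j * deriv_args G H (b j) s.
Proof.
elim: s b => [|i s IH] b /=; first by rewrite big1// => j _; rewrite mulr0.
by rewrite IH -big_split; apply: eq_bigr => j _; rewrite mulrDr.
Qed.

Lemma eq_deriv_args (R : comNzRingType) (V : lmodType R) (I : Type) (G H : I -> V)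
    (b b' : seq V -> R) s : b =1 b' -> deriv_args G H b s = deriv_args G H b' s.
Proof.
elim: s b b' => //= i s IH b b' bb; rewrite bb; congr (_ + _).
by apply: IH => t; rewrite bb.
Qed.

(** * Exterior calculus on open subsets of a vector space *)

Section FlatForms.
Context {R : realType} {m : nat}.
Notation V := 'rV[R]_m.
Implicit Types (b : V -> seq V -> R) (U : set V).

Definition flat_form k U b :=
  (forall y, U y -> alternating k (b y)) /\ (forall s, smooth U (fun y => b y s)).

Definition dflat b (y : V) (s : seq V) : R :=
  asum (fun v t => 'D_v (fun z => b z t) y) s.

Lemma alternating_derive k U b y v : open U -> flat_form k U b -> U y ->
  alternating k (fun t => 'D_v (fun z => b z t) y).
Proof.
move=> oU [ha hs] Uy; have db t : derivable (fun z => b z t) y v.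
  exact: smooth_derivable (hs t) Uy.
have z t : (forall z, U z -> b z t = 0) -> 'D_v (fun z => b z t) y = 0.
  by move=> h; rewrite (near_eq_derive _ (open_near oU Uy h)) derive_cst.
split.
- by move=> s sk; apply: z => w Uw; exact: (alt_size (ha w Uw)).
- move=> s t c u w; apply: (derive_scalar_lin oU Uy) => // x Ux.
  exact: (alt_lin (ha x Ux)).
- by move=> s t r w; apply: z => x Ux; exact: (alt_rep (ha x Ux)).
Qed.

Lemma alternating_dflat k U b y : open U -> flat_form k U b -> U y ->
  alternating k.+1 (dflat b y).
Proof.
move=> oU hb Uy; apply: alternating_asum => [v|c u v t].
  exact: alternating_derive oU hb Uy.
by apply: derive_lin; exact: smooth_differentiable (hb.2 t) Uy.
Qed.

Lemma flat_form_dflat k U b : open U -> flat_form k U b -> flat_form k.+1 U (dflat b).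
Proof.
move=> oU hb; split=> [y Uy|s]; first exact: alternating_dflat hb Uy.
by apply: smooth_asum => // v t; exact: smooth_derive _ (hb.2 t).
Qed.

Lemma eq_dflat U b b' y s : open U -> U y -> (forall z t, U z -> b z t = b' z t) ->
  dflat b y s = dflat b' y s.
Proof.
move=> oU Uy bb; apply: eq_asum => v t _ _.
by apply: near_eq_derive; apply: (open_near oU Uy) => z /bb.
Qed.

End FlatForms.

Section FlatPullback.
Context {R : realType} {m m' : nat}.
Notation V := 'rV[R]_m.
Notation W := 'rV[R]_m'.
Context (U : set V) (U' : set W) (T : V -> W) (b : W -> seq W -> R) (k : nat).
Hypotheses (oU : open U) (oU' : open U') (TU : forall y, U y -> U' (T y)).
Hypotheses (hT : smooth U T) (hb : flat_form k U' b).

Lemma alt_expand z s t (v : W) : U' z ->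
  b z (s ++ v :: t) = \sum_(i <- index_enum 'I_m') v 0 i * b z (rcons s (delta_mx 0 i) ++ t).
Proof.
move=> U'z; have ha := hb.1 z U'z; rewrite {1}(row_sum_delta v) (alt_sum ha).
by apply: eq_bigr => i _; rewrite (altZ ha) cat_rcons.
Qed.

(** The moving arguments are replaced by basis vectors one at a time and stored in [pre]; each
    replacement puts the dependence on [y] into a scalar coefficient. *)
Lemma smooth_args (I : Type) (X : I -> V -> W) s pre :
  (forall i, smooth U (X i)) ->
  smooth U (fun y => b (T y) (pre ++ [seq X i y | i <- s])).
Proof.
move=> hX; elim: s pre => [|i s IH] pre /=.
  exact: (smooth_comp oU TU hT (hb.2 (pre ++ [::]))).
apply: (@smooth_eq _ _ _ U (fun y => \sum_(j <- index_enum 'I_m') X i y 0 j *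
    b (T y) (rcons pre (delta_mx 0 j) ++ [seq X i y | i <- s])) _ oU).
  by move=> y Uy; rewrite alt_expand//; exact: TU.
apply: smooth_sum => // j; apply: smoothM => //.
exact: (smooth_coordP _ oU).1 (hX i) j.
Qed.

(** Chain rule in the base point plus Leibniz rule in the arguments, by the same expansion along the
    basis. *)
Lemma derive_args (I : Type) (X : I -> V -> W) s pre y v :
  (forall i, smooth U (X i)) -> U y ->
  'D_v (fun y => b (T y) (pre ++ [seq X i y | i <- s])) y =
  'D_('D_v T y) (fun z => b z (pre ++ [seq X i y | i <- s])) (T y) +
  deriv_args (X^~ y) (fun i => 'D_v (X i) y) (fun t => b (T y) (pre ++ t)) s.
Proof.
move=> hX Uy; have U'y := TU Uy.
elim: s pre => [|i s IH] pre /=.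
  rewrite addr0; apply: (derive_comp (g := fun z => b z (pre ++ [::]))).
    exact (smooth_differentiable hT Uy).
  exact (smooth_differentiable (hb.2 _) U'y).
pose P j := rcons pre (delta_mx 0 j) : seq W.
have hXj j : smooth U (fun y => X i y 0 j) by exact: (smooth_coordP _ oU).1 (hX i) j.
have hbj j := smooth_args s (P j) hX.
have E1 : 'D_v (fun y => b (T y) (pre ++ X i y :: [seq X i y | i <- s])) y =
   'D_v (fun y => \sum_(j <- index_enum 'I_m') X i y 0 j *
     b (T y) (P j ++ [seq X i y | i <- s])) y.
  apply: near_eq_derive; apply: (open_near oU Uy) => z Uz.
  by rewrite alt_expand//; exact: TU.
rewrite E1 derive_sumr; last first.
  by move=> j; exact (smooth_derivable (smoothM oU (hXj j) (hbj j)) Uy).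
have E2 : 'D_('D_v T y) (fun z => b z (pre ++ X i y :: [seq X i y | i <- s])) (T y) =
   \sum_(j <- index_enum 'I_m') X i y 0 j *
     'D_('D_v T y) (fun z => b z (P j ++ [seq X i y | i <- s])) (T y).
  rewrite (near_eq_derive (g := fun z => \sum_(j <- index_enum 'I_m') X i y 0 j *
     b z (P j ++ [seq X i y | i <- s]))); last first.
    by apply: (open_near oU' U'y) => z U'z; exact: alt_expand.
  rewrite derive_sumr => [|j].
    apply: eq_bigr => j _; refine (@deriveMl _ _ _ _ _ _ _).
    exact (smooth_derivable (hb.2 _) U'y).
  by exact (smooth_derivable (smoothM oU' (smooth_cst _ _) (hb.2 _)) U'y).
have E3 : deriv_args (X^~ y) (fun i => 'D_v (X i) y) (fun t => b (T y) (pre ++ X i y :: t)) s =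
   \sum_(j <- index_enum 'I_m') X i y 0 j *
     deriv_args (X^~ y) (fun i => 'D_v (X i) y) (fun t => b (T y) (P j ++ t)) s.
  rewrite -deriv_args_comb; apply: eq_deriv_args => t; exact: alt_expand.
rewrite E2 E3 (alt_expand _ _ ('D_v (X i) y) U'y) [RHS]addrCA -!big_split.
apply: eq_bigr => j _ /=.
rewrite (deriveM (smooth_derivable (hXj j) Uy) (smooth_derivable (hbj j) Uy)) IH.
rewrite (derive_mx (smooth_derivable (hX i) Uy)) mxE -/(P j).
by rewrite /GRing.scale /=; ring.
Qed.

Definition flat_pull (y : V) (s : seq V) : R := b (T y) [seq 'D_v T y | v <- s].

Lemma alternating_comp_linear (n : nat) (c : seq W -> R) (L : V -> W) :
  (forall a u v, L (a *: u + v) = a *: L u + L v) -> alternating n c ->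
  alternating n (fun s => c (map L s)).
Proof.
move=> hL hc; split.
- by move=> s sn; rewrite (alt_size hc)// size_map.
- by move=> s t a u v; rewrite !map_cat /= hL (alt_lin hc).
- by move=> s t r v; rewrite !map_cat /= map_cat /= (alt_rep hc).
Qed.

Lemma flat_form_pull : flat_form k U flat_pull.
Proof.
split=> [y Uy|s].
  apply: alternating_comp_linear => [a u v|]; last exact: hb.1 (TU Uy).
  exact: derive_lin (smooth_differentiable hT Uy).
apply: (smooth_args (X := fun v => 'D_v T) s [::]) => v.
exact: smooth_derive hT.
Qed.

(** The derivative of the base point yields the pullback of [dflat b]; the derivatives of the
    arguments are second derivatives of [T], symmetric by Schwarz's theorem, and cancel in the
    alternating sum. *)
Lemma dflat_pull y s : U y ->
  dflat flat_pull y s = dflat b (T y) [seq 'D_v T y | v <- s].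
Proof.
move=> Uy; have hX v : smooth U ('D_v T) by exact: smooth_derive hT.
rewrite /dflat asum_map.
pose q u t := 'D_('D_u T y) (fun z => b z [seq 'D_v T y | v <- t]) (T y).
pose r u t := deriv_args (fun v => 'D_v T y) (fun v => 'D_u ('D_v T) y) (b (T y)) t.
transitivity (asum (fun u t => q u t + r u t) s).
  by apply: eq_asum => u t _ _; refine (derive_args t [::] u hX Uy).
have r0 : asum r s = 0.
  refine (@asum_deriv_args _ _ _ (fun v => 'D_v T y) (fun u v => 'D_u ('D_v T) y)
    k _ s (hb.1 _ (TU Uy)) _) => u v.
  refine (smooth_derive_comm _ _ oU hT Uy).
by rewrite asumD r0 addr0.
Qed.

End FlatPullback.

(** * Transfer of the calculus to manifolds *)

Section ManifoldCalculus.
Context {R : realType} {m : nat} {M : manifold R m}.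
Implicit Types (p q : M) (a : diff_form M).

Lemma chart_im_chart p q : chart_dom p q -> chart_im p (chart p q).
Proof. by exists q. Qed.

Lemma param_dom p y : chart_im p y -> chart_dom p (param p y).
Proof. by move=> [q pq <-]; rewrite (chartK pq). Qed.

Lemma paramK p y : chart_im p y -> chart p (param p y) = y.
Proof. by move=> [q pq <-]; rewrite (chartK pq). Qed.

Lemma open_chart_im p : open (chart_im p).
Proof. exact: chart_im_open. Qed.
Arguments open_chart_im : clear implicits.

Lemma chart_im_center p : chart_im p (chart p p).
Proof. exact/chart_im_chart/chart_dom_mem. Qed.

Lemma param_center p : param p (chart p p) = p.
Proof. exact/chartK/chart_dom_mem. Qed.

(* The maps into a manifold whose domain is an open subset [U] of a vector
   space: charts' inverses, and these composed with maps of manifolds. *)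
Definition smooth_on (l : nat) (U : set 'rV[R]_l) (T : 'rV[R]_l -> M) : Prop :=
  [/\ open U, forall y, U y -> {for y, continuous T}
    & forall q, smooth [set y | U y /\ chart_dom q (T y)] (chart q \o T)].

Lemma smooth_on_param p : smooth_on (chart_im p) (param p).
Proof.
split; first exact: open_chart_im; last by move=> q; exact: transition_smooth.
by move=> y py; exact: param_continuous.
Qed.

Section SmoothOn.
Context {l : nat} {U : set 'rV[R]_l} {T : 'rV[R]_l -> M} (hT : smooth_on U T).

Lemma open_smooth_on (A : set M) : open A -> open [set y | U y /\ A (T y)].
Proof.
move=> oA; have [oU cT _] := hT; rewrite openE => y [Uy Ay].
apply: filterI; first exact: open_nbhs_nbhs.
by apply: (cT y Uy); exact: open_nbhs_nbhs.
Qed.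

Lemma differentiable_chart q y : U y -> chart_dom q (T y) ->
  differentiable (chart q \o T) y.
Proof.
move=> Uy qy; have [_ _ hs] := hT.
exact (smooth_differentiable (hs q) (conj Uy qy)).
Qed.

End SmoothOn.

Lemma derive_chart (l : nat) (U : set 'rV[R]_l) (T : 'rV[R]_l -> M) q q' y v :
  smooth_on U T -> U y -> chart_dom q (T y) -> chart_dom q' (T y) ->
  'D_v (chart q' \o T) y =
  'D_('D_v (chart q \o T) y) (chart q' \o param q) (chart q (T y)).
Proof.
move=> hT Uy qy q'y.
have e : {near y, chart q' \o T =1 (chart q' \o param q) \o (chart q \o T)}.
  apply: (open_near (open_smooth_on hT (chart_dom_open q)) (conj Uy qy)) => z [Uz qz].
  by rewrite /= (chartK qz).
rewrite (near_eq_derive v e); apply: derive_comp.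
  exact (differentiable_chart hT Uy qy).
apply (differentiable_chart (smooth_on_param q)); first exact: chart_im_chart.
by rewrite (chartK qy).
Qed.

Lemma diff_inE (l : nat) (U : set 'rV[R]_l) (T : 'rV[R]_l -> M) y v :
  smooth_on U T -> U y -> diff_in T y v = 'D_v (chart (T y) \o T) y.
Proof.
move=> hT Uy; refine (esym (deriveE _ (differentiable_chart hT Uy _))).
exact: chart_dom_mem.
Qed.

Lemma derive_chart_param p y v : chart_im p y -> 'D_v (chart p \o param p) y = v.
Proof.
move=> py; have e : {near y, chart p \o param p =1 id}.
  by apply: (open_near (open_chart_im p) py) => z /paramK.
by rewrite (near_eq_derive v e) derive_id.
Qed.

Lemma diff_in_center p v : diff_in (param p) (chart p p) v = v.
Proof.
rewrite (diff_inE _ (smooth_on_param p) (chart_im_center p)) param_center.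
exact: derive_chart_param (chart_im_center p).
Qed.

Lemma diff_inK p q v : chart_dom p q ->
  diff_in (param p) (chart p q) (diff_out (chart p) q v) = v.
Proof.
move=> pq; have hq := chart_im_center q.
have pq' : chart_dom p (param q (chart q q)) by rewrite param_center.
rewrite (diff_inE _ (smooth_on_param p) (chart_im_chart pq)) (chartK pq).
rewrite /diff_out -(deriveE _ (differentiable_chart (smooth_on_param q) hq pq')).
have qq' : chart_dom q (param q (chart q q)) by exact: param_dom.
have := derive_chart v (smooth_on_param q) hq pq' qq'.
by rewrite (derive_chart_param _ hq) param_center => <-.
Qed.

Lemma diff_out_diff_in p q y v : chart_im q y -> chart_dom p (param q y) ->
  diff_out (chart p) (param q y) (diff_in (param q) y v) = 'D_v (chart p \o param q) y.
Proof.
move=> qy; set x := param q y => px.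
have hx := chart_im_center x.
have px' : chart_dom p (param x (chart x x)) by rewrite param_center.
rewrite (diff_inE _ (smooth_on_param q) qy).
rewrite /diff_out -(deriveE _ (differentiable_chart (smooth_on_param x) hx px')).
by rewrite -(derive_chart v (smooth_on_param q) qy (chart_dom_mem x) px).
Qed.

Lemma diff_outK p y v : chart_im p y ->
  diff_out (chart p) (param p y) (diff_in (param p) y v) = v.
Proof.
move=> py; rewrite (diff_out_diff_in _ py (param_dom py)).
exact: derive_chart_param py.
Qed.

Definition pull (l : nat) (T : 'rV[R]_l -> M) a (y : 'rV[R]_l) (s : seq 'rV[R]_l) : R :=
  a (T y) [seq diff_in T y v | v <- s].

(** [diff_in T y] refers to the chart at [T y], which varies with [y]. The fixed chart [q] can
    replace it locally, and the flat results then apply. *)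
Lemma pull_chart (l : nat) (U : set 'rV[R]_l) (T : 'rV[R]_l -> M) q a y s :
  smooth_on U T -> U y -> chart_dom q (T y) ->
  pull T a y s = flat_pull (chart q \o T) (form_loc q a) y s.
Proof.
move=> hT Uy qy; rewrite /pull /flat_pull /form_loc /= (chartK qy) -map_comp.
congr (a _ _); apply: eq_map => v /=.
rewrite (diff_inE _ hT Uy) (diff_inE _ (smooth_on_param q) (chart_im_chart qy)) (chartK qy).
by rewrite -(derive_chart v hT Uy qy (chart_dom_mem (T y))).
Qed.

Lemma is_form_alternating k a p : is_form k a -> alternating k (a p).
Proof. by move=> [h1 h2 h3 _]; split; [exact: h1|exact: h2|exact: h3]. Qed.

Lemma flat_form_loc k a p : is_form k a -> flat_form k (chart_im p) (form_loc p a).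
Proof.
move=> ha; split; last by have [_ _ _ h] := ha; exact: h.
move=> y py; apply: alternating_comp_linear; last exact: is_form_alternating.
by move=> c u v; rewrite /diff_in linearP.
Qed.

Lemma flat_form_pull_on k (l : nat) (U : set 'rV[R]_l) (T : 'rV[R]_l -> M) a :
  smooth_on U T -> is_form k a -> flat_form k U (pull T a).
Proof.
move=> hT ha; split=> [y Uy|s].
  apply: alternating_comp_linear; last exact: is_form_alternating.
  by move=> c u v; rewrite /diff_in linearP.
apply: smooth_local => y Uy; set q := T y; have [_ _ hs] := hT.
exists [set y | U y /\ chart_dom q (T y)]; first by split=> //; exact: chart_dom_mem.
have oUq := open_smooth_on hT (chart_dom_open q).
apply: (smooth_eq oUq (f := flat_pull (chart q \o T) (form_loc q a) ^~ s)).
  by move=> z [Uz qz]; rewrite (pull_chart _ _ hT Uz qz).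
have im z : U z /\ chart_dom q (T z) -> chart_im q (chart q (T z)).
  by case=> _; exact: chart_im_chart.
exact: (flat_form_pull oUq im (hs q) (flat_form_loc q ha)).2.
Qed.

Lemma ext_derivE a p s : ext_deriv a p s = dflat (form_loc p a) (chart p p) s.
Proof.
rewrite /ext_deriv /dflat.
apply: (asum_bigE (fun v t => 'D_v (fun z => form_loc p a z t) (chart p p)) s 0
  (c := fun i w => (-1) ^+ i * w)) => [w|i w]; first by rewrite expr0 mul1r.
by rewrite exprS mulN1r mulNr.
Qed.

Lemma dflat_pull_on k (l : nat) (U : set 'rV[R]_l) (T : 'rV[R]_l -> M) a y s :
  smooth_on U T -> is_form k a -> U y ->
  dflat (pull T a) y s = pull T (ext_deriv a) y s.
Proof.
move=> hT ha Uy; set q := T y; have [_ _ hs] := hT.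
have oUq := open_smooth_on hT (chart_dom_open q).
have qy : chart_dom q (T y) by exact: chart_dom_mem.
rewrite (eq_dflat (U := [set y | U y /\ chart_dom q (T y)])
  (b' := flat_pull (chart q \o T) (form_loc q a)) s oUq (conj Uy qy)); last first.
  by move=> z t [Uz qz]; exact: pull_chart hT Uz qz.
have im z : U z /\ chart_dom q (T z) -> chart_im q (chart q (T z)).
  by case=> _; exact: chart_im_chart.
rewrite (dflat_pull oUq (open_chart_im q) im (hs q) (flat_form_loc q ha) s (conj Uy qy)).
rewrite /pull ext_derivE; congr (dflat _ _ _).
by apply: eq_map => v; rewrite (diff_inE _ hT Uy).
Qed.

(** [ext_deriv] is computed at each point in the preferred chart there; this is its independence of
    the chart. *)
Lemma form_loc_ext_deriv k a p y s : is_form k a -> chart_im p y ->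
  form_loc p (ext_deriv a) y s = dflat (form_loc p a) y s.
Proof. move=> ha py; exact (esym (dflat_pull_on s (smooth_on_param p) ha py)). Qed.

Lemma is_form_ext_deriv k a : is_form k a -> is_form k.+1 (ext_deriv a).
Proof.
move=> ha.
have h p : alternating k.+1 (ext_deriv a p).
  rewrite (_ : ext_deriv a p = dflat (form_loc p a) (chart p p)).
    exact: alternating_dflat (open_chart_im p) (flat_form_loc p ha) (chart_im_center p).
  by apply/funext => s; exact: ext_derivE.
split.
- by move=> p; have [] := h p.
- by move=> p; have [] := h p.
- by move=> p; have [] := h p.
move=> p s; apply: (smooth_eq (open_chart_im p) (f := dflat (form_loc p a) ^~ s)).
  by move=> y py; rewrite -(form_loc_ext_deriv s ha py).
exact: (flat_form_dflat (open_chart_im p) (flat_form_loc p ha)).2.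
Qed.

Lemma form_loc_interior (X : vfield M) a p y s : chart_im p y ->
  form_loc p (interior_prod X a) y s = form_loc p a y (vf_loc p X y :: s).
Proof.
move=> py; rewrite /form_loc /interior_prod /= /vf_loc.
by rewrite -[X in diff_in _ X](paramK py) (diff_inK _ (param_dom py)).
Qed.

Lemma is_form_interior k (X : vfield M) a : smooth_vf X -> is_form k.+1 a ->
  is_form k (interior_prod X a).
Proof.
move=> hX ha.
have h p : alternating k (interior_prod X a p).
  exact: alt_cons (is_form_alternating p ha).
split.
- by move=> p; have [] := h p.
- by move=> p; have [] := h p.
- by move=> p; have [] := h p.
move=> p s; have op := open_chart_im p.
(* [None] marks the vector field and [Some v] a constant argument, so that one list of moving
   arguments holds both. *)
pose Y (i : option 'rV[R]_m) (y : 'rV[R]_m) := if i is Some v then v else vf_loc p X y.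
have hY i : smooth (chart_im p) (Y i) by case: i => [v|]; [exact: smooth_cst|exact: hX].
apply: (smooth_eq op _ (smooth_args op (fun y => id) (@smooth_id _ _ _) (flat_form_loc p ha)
  (None :: map Some s) [::] hY)) => y py.
by rewrite /= form_loc_interior// -map_comp map_id.
Qed.

End ManifoldCalculus.

Arguments open_chart_im {R m M} p.

(** * Pullback of forms along a smooth map *)

Section Pullback.
Context {R : realType} {m1 m2 : nat} {M1 : manifold R m1} {M2 : manifold R m2}.
Context (F : M1 -> M2) (hF : smooth_map F).

Lemma smooth_on_comp_param p : smooth_on (chart_im p) (F \o param p).
Proof.
split; first exact: open_chart_im; last by move=> q; exact: hF.2.
move=> y py; apply: continuous_comp; first exact: param_continuous.
exact: hF.1.
Qed.

Lemma pushforward_diff_in (l : nat) (U : set 'rV[R]_l) (T : 'rV[R]_l -> M1) y v :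
  smooth_on U T -> U y ->
  Defs.pushforward F (T y) (diff_in T y v) = diff_in (F \o T) y v.
Proof.
move=> hT Uy; set q := T y.
have hq := chart_im_center q; have qq := chart_dom_mem q.
have dF : chart_dom (F q) ((F \o param q) (chart q q)).
  by rewrite /= param_center; exact: chart_dom_mem.
have D1 : differentiable (chart (F q) \o F \o param q) (chart q q).
  exact (differentiable_chart (smooth_on_comp_param q) hq dF).
have D2 : differentiable (chart q \o T) y by exact (differentiable_chart hT Uy qq).
have e : {near y, (chart (F q) \o F \o param q) \o (chart q \o T) =1 chart (F q) \o F \o T}.
  apply: (open_near (open_smooth_on hT (chart_dom_open q)) (conj Uy qq)).
  by move=> z [Uz qz]; rewrite /= (chartK qz).
have [_ dE] := near_eq_diff e (differentiable_comp D2 D1).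
refine (etrans _ (esym (congr1 (fun d => d v) dE))).
exact (esym (congr1 (fun d => d v) (diff_comp D2 D1))).
Qed.

Lemma form_loc_pullback p a y s : chart_im p y ->
  form_loc p (pullback F a) y s = pull (F \o param p) a y s.
Proof.
move=> py.
have E : [seq Defs.pushforward F (param p y) w | w <- [seq diff_in (param p) y v | v <- s]] =
    [seq diff_in (F \o param p) y v | v <- s].
  refine (etrans (esym (map_comp _ _ _)) _).
  apply: eq_map => v.
  exact (pushforward_diff_in v (smooth_on_param p) py).
exact (congr1 (a (F (param p y))) E).
Qed.

Lemma is_form_pullback k a : is_form k a -> is_form k (pullback F a).
Proof.
move=> ha.
have h p : alternating k (pullback F a p).
  apply: alternating_comp_linear; last exact: is_form_alternating.
  by move=> c u v; rewrite /Defs.pushforward /diff_out linearP.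
split.
- by move=> p; have [] := h p.
- by move=> p; have [] := h p.
- by move=> p; have [] := h p.
move=> p s; apply: (smooth_eq (open_chart_im p) (f := pull (F \o param p) a ^~ s)).
  by move=> y py; rewrite form_loc_pullback.
exact: (flat_form_pull_on (smooth_on_comp_param p) ha).2.
Qed.

Lemma ext_deriv_pullback k a : is_form k a ->
  ext_deriv (pullback F a) = pullback F (ext_deriv a).
Proof.
move=> ha; apply/funext => p; apply/funext => s; rewrite ext_derivE.
have hp := chart_im_center p; have hFp := smooth_on_comp_param p.
rewrite (eq_dflat s (open_chart_im p) hp (b' := pull (F \o param p) a)).
  rewrite (dflat_pull_on s hFp ha hp) /pull /= /pullback.
  by rewrite /diff_in /Defs.pushforward /diff_out /= param_center.
by move=> z t pz; exact: form_loc_pullback.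
Qed.

End Pullback.

Lemma pushforwardK (R : realType) (m1 m2 : nat) (M1 : manifold R m1) (M2 : manifold R m2)
    (F : M1 -> M2) (G : M2 -> M1) p v :
  smooth_map F -> smooth_map G -> cancel F G ->
  Defs.pushforward G (F p) (Defs.pushforward F p v) = v.
Proof.
move=> hF hG FG; have hp := chart_im_center p; have sp := smooth_on_param p.
have := pushforward_diff_in hG v (smooth_on_comp_param hF p) hp.
have -> : G \o (F \o param p) = param p by apply/funext => z; rewrite /= FG.
by rewrite -(pushforward_diff_in hF v sp hp) /= diff_in_center param_center.
Qed.

(** * Uniqueness for a singular linear differential equation *)

Section LinearODE.
Context {R : realType}.

Lemma derivable_continuous_within (f df : R -> R) (A : set R) :
  (forall t : R, is_derive t 1 f (df t)) -> {within A, continuous f}.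
Proof.
move=> hf; apply: continuous_subspaceT => t.
by apply: differentiable_continuous; apply/derivable1_diffP; have [] := hf t.
Qed.

(* At [t = 0] the equation [t g' = k g] is singular, but [k t / t] is bounded. *)
Lemma singular_ode_eq0 (g k dg dk : R -> R) :
  (forall t : R, is_derive t 1 g (dg t)) -> (forall t : R, is_derive t 1 k (dk t)) ->
  continuous dk -> k 0 = 0 -> (forall t, t * dg t = k t * g t) -> g 0 = 0 ->
  g 1 = 0.
Proof.
move=> hg hk cdk k0 E g0.
(* The maximum of the derivative of [k] on the unit interval bounds [k t / t], by the mean value
   theorem and [k 0 = 0]. *)
have [c _ hc] : exists2 c, c \in `[0, 1]%R & forall t, t \in `[0, 1]%R -> `|dk t| <= `|dk c|.
  apply: (@EVT_max R (fun t => `|dk t|)) => //.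
  by apply: continuous_subspaceT => t; apply: continuous_comp; [exact: cdk|exact: norm_continuous].
set C := `|dk c| in hc.
have kC t : 0 < t < 1 -> k t <= C * t.
  move=> /andP[t0 t1]; have [s] := MVT t0 (fun x _ => hk x) (derivable_continuous_within hk).
  rewrite in_itv/= => /andP[s0 st]; rewrite k0 !subr0 => ->.
  rewrite ler_wpM2r ?(ltW t0)// (le_trans (ler_norm _))// hc// in_itv/= (ltW s0)/=.
  by rewrite ltW// (lt_trans st).
have dgC t : 0 < t < 1 -> g t * dg t <= C * (g t) ^+ 2.
  move=> t01; have /andP[t0 _] := t01.
  rewrite -(ler_pM2l t0).
  have -> : t * (g t * dg t) = k t * g t ^+ 2 by rewrite mulrCA E; ring.
  have -> : t * (C * g t ^+ 2) = C * t * g t ^+ 2 by ring.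
  by rewrite ler_wpM2r ?sqr_ge0 ?kC.
(* Grönwall's argument: with this integrating factor the square of [g] cannot increase from its
   initial value 0. *)
pose h t := g t * g t * expR (- (2 * C) * t).
pose dh t := (2 * (g t * dg t) - 2 * C * g t ^+ 2) * expR (- (2 * C) * t).
have hh (t : R) : is_derive t 1 h (dh t).
  have hl : is_derive t 1 (fun t => - (2 * C) * t) (- (2 * C)).
    have := is_deriveZ (- (2 * C)) (is_derive_id t 1).
    by move=> hZ; apply: is_derive_eq hZ _; exact: mulr1.
  have he := is_derive1_comp (is_derive_expR (- (2 * C) * t)) hl.
  have hgg := is_deriveM (hg t) (hg t).
  have := is_deriveM hgg he; move/is_derive_eq; apply.
  rewrite /dh; set x := expR _.
  change (g t * g t * (x * - (2 * C)) + x * (g t * dg t + g t * dg t) =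
    (2 * (g t * dg t) - 2 * C * g t ^+ 2) * x).
  by ring.
have : h 1 <= h 0.
  apply: (@ler0_derive1_nincr R h 0 1) => //.
  - move=> t; rewrite in_itv/= => t01; rewrite derive1E; rewrite (@derive_val _ _ _ _ _ _ _ (hh t)).
    rewrite /dh mulr_le0_ge0 ?expR_ge0// subr_le0 -mulrA ler_pM2l//.
    exact: dgC.
  - exact: derivable_continuous_within hh.
rewrite /h g0 !mul0r pmulr_lle0 ?expR_gt0// -expr2 => g1.
by apply/eqP; rewrite -sqrf_eq0 eq_le g1 sqr_ge0.
Qed.

End LinearODE.

Section SmoothOut.
Context {R : realType} {m : nat} {M : manifold R m}.

Lemma smooth_out_continuous (W : normedModType R) (A : set M) (f : M -> W) q :
  A q -> smooth_out A f -> {for q, continuous f}.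
Proof.
move=> Aq hf.
have c1 : {for chart q q, continuous (f \o param q)}.
  refine (smooth_continuous (hf q) _); split; first exact: chart_im_center.
  by rewrite param_center.
have c2 := @continuous_comp _ _ _ (chart q) (f \o param q) q
  (chart_continuous (chart_dom_mem q)) c1.
have e : {near q, (f \o param q) \o chart q =1 f}.
  apply: filterS (open_nbhs_nbhs (conj (chart_dom_open q) (chart_dom_mem q))) => z qz.
  by rewrite /= (chartK qz).
change (f @ q --> f q).
have <- : ((f \o param q) \o chart q) q = f q by rewrite /= param_center.
by apply: cvg_trans c2; exact: near_eq_cvg.
Qed.

Lemma smooth_out_comp (A : set M) (f : M -> R) l (U : set 'rV[R]_l)
    (T : 'rV[R]_l -> M) :
  open A -> smooth_out A f -> smooth_on U T -> (forall y, U y -> A (T y)) ->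
  smooth U (f \o T).
Proof.
move=> oA hf hT UA; apply: smooth_local => y Uy; set q := T y; have [_ _ hs] := hT.
have oUq := open_smooth_on hT (chart_dom_open q).
exists [set y | U y /\ chart_dom q (T y)]; first by split=> //; exact: chart_dom_mem.
apply: (smooth_eq oUq (f := (f \o param q) \o (chart q \o T))).
  by move=> z [Uz qz]; rewrite /= (chartK qz).
apply: (smooth_comp oUq _ (hs q) (hf q)) => z [Uz qz]; split; first exact: chart_im_chart.
by rewrite /= (chartK qz); exact: UA.
Qed.

Lemma smooth_on_in l (psi : 'rV[R]_l -> M) : smooth_in psi -> smooth_on setT psi.
Proof.
move=> [cpsi spsi]; split; first exact: openT.
  by move=> y _; exact: cpsi.
by move=> q; apply: smooth_sub (spsi q) => y [].
Qed.

End SmoothOut.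

(** * The Euler field and the ray equation *)

Section FlatEuler.
Context {R : realType} {m : nat}.
Notation V := 'rV[R]_m.
Context (b : V -> seq V -> R) (k : nat) (hb : flat_form k.+1 setT b).

Lemma derive_euler_args y v t :
  'D_v (fun z => b z (z :: t)) y = 'D_v (fun z => b z (y :: t)) y + b y (v :: t).
Proof.
pose X (i : option V) (z : V) := if i is Some u then u else z.
have hX i : smooth setT (X i) by case: i => [u|]; [exact: smooth_cst|exact: smooth_id].
have E z : [seq X i z | i <- None :: map Some t] = z :: t.
  by rewrite /= -map_comp; congr cons; elim: t => //= a t ->.
have -> : (fun z => b z (z :: t)) =
    fun z => b (id z) ([::] ++ [seq X i z | i <- None :: map Some t]).
  by apply/funext => z; rewrite E.
rewrite (derive_args openT openT (fun _ _ => I) (@smooth_id _ _ _) hb (None :: map Some t)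
  [::] v hX I) derive_id; congr (_ + _); first by rewrite E.
have [E1 E2] : (forall s, [seq X i y | i <- map Some s] = s) /\
    (forall u, 'D_v (X (Some u)) y = 0).
  split; first by elim=> //= a s ->.
  by move=> u; exact: derive_cst.
rewrite /= E1 derive_id -[RHS]addr0; congr (_ + _).
have := alt_cons y (hb.1 y I); move: {E E1}(fun s => b y (y :: s)) => c.
elim: t k c => //= u t IH j c hc; rewrite E2 (alt0 hc [::]) add0r.
case: j hc => [hc|j hc]; last exact: IH (alt_cons u hc).
by rewrite deriv_args_eq0// => s; exact: alt_cons0 hc _.
Qed.

(* Cartan's formula for the Euler field, [b] being closed. *)
Lemma dflat_euler y s : dflat b y (y :: s) = 0 ->
  dflat (fun z t => b z (z :: t)) y s =
  'D_y (fun z => b z s) y + (size s)%:R * b y s.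
Proof.
rewrite /dflat /= => /eqP; rewrite subr_eq0 => /eqP ->.
rewrite -(asum_cons s (hb.1 y I)) -asumD.
by apply: eq_asum => v t _ _; exact: derive_euler_args.
Qed.

End FlatEuler.

Section Liouville.
Context {R : realType} {m : nat} {M : manifold R m}.
Context {n : nat} {w : diff_form M} (hw : n_plectic n w).
Context {K : set M} {D : vfield M} {f : M -> R}.
Hypotheses (m_gt0 : (0 < m)%N) (cK : compact K) (hD : smooth_vf D) (DK : supp D `<=` K).
Hypotheses (hf : smooth_out setT f) (Lf : lie_deriv D w = form_scale f w).

Lemma nondegenerate_neq0 (q : M) : exists s, w q s != 0.
Proof.
have [_ _ nd] := hw; apply: contrapT => h.
have z s : w q s = 0 by apply/eqP/negP => /negP ws; apply: h; exists s.
have /rowP/(_ (Ordinal m_gt0)) := nd q (const_mx 1) (fun s => z _).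
by rewrite !mxE => /eqP; rewrite oner_eq0.
Qed.

Lemma ext_deriv_iota : ext_deriv (interior_prod D w) = form_scale f w.
Proof.
have [_ dw _] := hw; rewrite -Lf /lie_deriv dw -[LHS]addr0; congr (_ + _).
Qed.

(** [D] vanishes on a neighbourhood of [q], hence so does [d (iota_D w) = f w] at [q], where [w] is
    nonzero. *)
Lemma conformal_factor_out q : ~ supp D q -> f q = 0.
Proof.
move=> nq; have [s ws] := nondegenerate_neq0 q.
have oA : open (~` supp D) by apply: closed_openC; exact: closed_closure.
have D0 z : ~ supp D z -> D z = 0.
  by move=> nz; apply: contrapT => /eqP Dz; apply: nz; exact: subset_closure.
have hq := smooth_on_param q.
have : ext_deriv (interior_prod D w) q s = f q * w q s by rewrite ext_deriv_iota.
rewrite ext_derivE.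
have -> : dflat (form_loc q (interior_prod D w)) (chart q q) s = dflat (fun _ _ => 0) (chart q q) s.
  apply: (eq_dflat s (open_smooth_on hq oA)).
    by split; [exact: chart_im_center|rewrite param_center].
  move=> z t [_ /D0 Dz]; rewrite /form_loc /interior_prod Dz.
  have [hf' _ _] := hw; exact: (alt0 (is_form_alternating _ hf') [::]).
rewrite /dflat asum_eq0 => [/esym/eqP|v t _ _]; last exact: derive_cst.
by rewrite mulf_eq0 (negbTE ws) orbF => /eqP.
Qed.

Context {phi : M -> 'rV[R]_m} {psi : 'rV[R]_m -> M}.
Hypotheses (phiK : forall q, interior (supp D) q -> psi (phi q) = q).
Hypotheses (psiK : forall x, interior (supp D) (psi x) /\ phi (psi x) = x).
Hypotheses (hphi : smooth_out (interior (supp D)) phi) (hpsi : smooth_in psi).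
Hypotheses (euler : forall q, interior (supp D) q -> diff_out phi q (D q) = phi q).

Let Omega := pull psi w.
Let hpsi' : smooth_on setT psi := smooth_on_in hpsi.

Lemma diff_in_phi y v : diff_in psi y (diff_out phi (psi y) v) = v.
Proof.
set q := psi y; have [iq pq] := psiK y.
have hq := chart_im_center q; have qq := chart_dom_mem q.
have D1 : differentiable (phi \o param q) (chart q q).
  by refine (smooth_differentiable (hphi q) _); split=> //; rewrite param_center.
have y' : (phi \o param q) (chart q q) = y by rewrite /= param_center.
have D2 : differentiable (chart q \o psi) ((phi \o param q) (chart q q)).
  by rewrite y'; exact (differentiable_chart hpsi' I qq).
rewrite (diff_inE _ hpsi' I) /diff_out -(deriveE _ D1) -/q -{1}y' -(derive_comp _ D1 D2).
have e : {near chart q q, (chart q \o psi) \o (phi \o param q) =1 id}.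
  apply: (open_near (open_smooth_on (smooth_on_param q) (open_interior (supp D)))).
    by split=> //; rewrite param_center.
  by move=> z [qz iz]; rewrite /= phiK// paramK.
by rewrite (near_eq_derive v e) derive_id.
Qed.

Lemma Omega_form : flat_form n.+1 setT Omega.
Proof. by have [h _ _] := hw; exact: flat_form_pull_on. Qed.

Lemma Omega_closed y s : dflat Omega y s = 0.
Proof. by have [h dw _] := hw; rewrite (dflat_pull_on s hpsi' h I) /pull dw. Qed.

Lemma Omega_neq0 y : exists s, Omega y s != 0.
Proof.
have [s ws] := nondegenerate_neq0 (psi y).
exists [seq diff_out phi (psi y) v | v <- s]; rewrite /Omega /pull.
have -> // : [seq diff_in psi y v | v <- [seq diff_out phi (psi y) v | v <- s]] = s.
by elim: s {ws} => //= a s ->; rewrite diff_in_phi.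
Qed.

(** This is [d (iota_D w) = f w] pulled back along [psi], which carries the Euler field to [D]. *)
Lemma euler_equation y s :
  'D_y (fun z => Omega z s) y + (size s)%:R * Omega y s = f (psi y) * Omega y s.
Proof.
have [hwf _ _] := hw.
rewrite -(dflat_euler Omega_form (Omega_closed y (y :: s))).
rewrite (eq_dflat s openT I (b' := pull psi (interior_prod D w))).
  rewrite (dflat_pull_on s hpsi' (is_form_interior hD hwf) I) /pull ext_deriv_iota.
  by [].
move=> z t _; rewrite /Omega /pull /interior_prod /=; congr (w _ (_ :: _)).
have [iz pz] := psiK z.
by rewrite -[RHS](diff_in_phi z) euler// pz.
Qed.

Lemma smooth_factor : smooth setT (f \o psi).
Proof. exact: (smooth_out_comp openT hf hpsi'). Qed.

Lemma size_Omega y s : Omega y s != 0 -> size s = n.+1.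
Proof.
move=> h; apply/eqP; apply: contraT => sn.
by rewrite (alt_size (Omega_form.1 y I) sn) eqxx in h.
Qed.

(** The Euler field vanishes at the origin, so the derivative term drops out. *)
Lemma conformal_factor_center : f (psi 0) = n.+1%:R.
Proof.
have [s s0] := Omega_neq0 0; have := euler_equation 0 s.
by rewrite derive0 add0r (size_Omega s0) => /(mulIf s0) ->.
Qed.

Lemma derive_scale (g : 'rV[R]_m -> R) y (t : R) x : differentiable g y ->
  'D_(t *: x) g y = t * 'D_x g y.
Proof. by move=> dg; rewrite !(deriveE _ dg) linearZ. Qed.

(** For [g t = Omega (t x) s] and [k t = f (psi (t x)) - (n+1)], the Euler equation at [t x] reads
    [t g' = k g], since differentiating along [t x] is [t] times differentiating along [x]. *)
Lemma Omega_ray x s : Omega 0 s = 0 -> Omega x s = 0.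
Proof.
move=> s0; case: (eqVneq (size s) n.+1) => [sn|/(alt_size (Omega_form.1 x I))//].
have sO := Omega_form.2 s; have sf := smooth_factor.
pose l (t : R) := 0 + t *: x.
have := @singular_ode_eq0 R (fun t => Omega (l t) s) (fun t => (f \o psi) (l t) - n.+1%:R)
  (fun t => 'D_x (Omega ^~ s) (l t)) (fun t => 'D_x (f \o psi) (l t)).
rewrite /l scale1r scale0r !add0r; apply=> [t|t|||t|//].
- by apply: is_derive_line; exact (smooth_derivable sO I).
- have h := is_derive_line (smooth_derivable (v := x) sf (I : setT (0 + t *: x))).
  by have := is_deriveB h (is_derive_cst (n.+1%:R : R) t 1); rewrite subr0.
- move=> t; have c1 : {for 0 + t *: x, continuous ('D_x (f \o psi))}.
    exact (smooth_continuous (smooth_derive x sf) I).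
  refine (@continuous_comp _ _ _ (fun t : R => 0 + t *: x) ('D_x (f \o psi)) t _ c1).
  by apply: cvgD; [exact: cvg_cst|exact: scalel_continuous].
- by rewrite /= conformal_factor_center subrr.
- have := euler_equation (0 + t *: x) s; rewrite sn add0r.
  rewrite (derive_scale _ _ (smooth_differentiable sO I)) => E.
  by rewrite mulrBl -[X in X - _]E addrK.
Qed.

Lemma Omega_const_ray x s : (forall y, 'D_x (fun z => Omega z s) y = 0) ->
  forall t : R, Omega (t *: x) s = Omega 0 s.
Proof.
move=> h t; have := @is_derive_0_is_cst R (fun t => Omega (0 + t *: x) s) t 0.
rewrite scale0r !add0r; apply=> u; rewrite -(h (0 + u *: x)).
by apply: is_derive_line; exact (smooth_derivable (Omega_form.2 s) I).
Qed.

Lemma conformal_factor_ray x s : x != 0 -> Omega 0 s != 0 ->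
  ~ (forall y, 'D_x (fun z => Omega z s) y = 0).
Proof.
move=> x0 s0 hx; have cst_s := Omega_const_ray hx.
have fray t : f (psi (t *: x)) = n.+1%:R.
  have := euler_equation (t *: x) s.
  rewrite (derive_scale _ _ (smooth_differentiable (Omega_form.2 s) I)) hx mulr0 add0r.
  by rewrite cst_s (size_Omega s0) => /(mulIf s0) ->.
(* The image of the ray stays in the compact set [K], hence clusters at some [q] as [t] tends to
   infinity. *)
have KF : ((fun t : R => psi (t *: x)) @ +oo%R) K.
  change (\forall t \near +oo%R, K (psi (t *: x))).
  by apply: nearW => t; apply: DK; have [it _] := psiK (t *: x); exact: interior_subset it.
have FN N : ((fun t : R => psi (t *: x)) @ +oo%R) [set psi (t *: x) | t in [set t | N < t]].
  change (\forall t \near +oo%R, [set psi (t *: x) | t in [set t | N < t]] (psi (t *: x))).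
  by apply: filterS (nbhs_pinfty_gt (num_real N)) => t Nt; exists t.
have [q [Kq cq]] := cK (fmap_proper_filter _ _) KF.
have cf := smooth_out_continuous (I : setT q) hf.
(* By continuity [f q = n+1], so [f] is nonzero near [q], which keeps a neighbourhood of [q] inside
   the support. *)
have iq : interior (supp D) q.
  have fq : f q = n.+1%:R.
    apply: contrapT => /eqP fq.
    have B : nbhs q [set z | f z != n.+1%:R] by exact: (cf _ (open_neq fq)).
    have [z [[t _ <-]]] := cq _ _ (FN 0) B.
    by rewrite /= fray eqxx.
  have f0 : f q != 0 by rewrite fq pnatr_eq0.
  have : nbhs q [set z | f z != 0] by exact: (cf _ (open_neq f0)).
  apply: filterS => z /= fz; apply: contrapT => /conformal_factor_out fz0.
  by rewrite fz0 eqxx in fz.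
(* So [phi] is continuous at [q], hence bounded near it, whereas it sends [psi (t x)] to [t x]; the
   threshold chosen for [t] forces the norm of [t x] above [1 + |phi q|]. *)
have cphi := smooth_out_continuous iq hphi.
have B : nbhs q [set z | `|phi q - phi z| < 1].
  by move/cvgrPdist_lt : cphi; apply.
have [z [[t /= tN <-]]] := cq _ _ (FN ((1 + `|phi q|) / `|x|)) B.
have [_ ->] := psiK (t *: x) => h.
have x_gt0 : 0 < `|x| by rewrite normr_gt0.
move: tN; rewrite ltr_pdivrMr// ltNge => /negP; apply.
have t0 : `|t *: x| <= 1 + `|phi q|.
  by rewrite -[t *: x](subrK (phi q)) (le_trans (ler_normD _ _))// lerD2r distrC ltW.
by rewrite (le_trans _ t0)// normrZ ler_wpM2r// ler_norm.
Qed.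

Lemma liouville_dim : m = n.+1.
Proof.
have [e e0] := Omega_neq0 0; have en := size_Omega e0.
have hO := Omega_form.1; apply/eqP; rewrite eqn_leq; apply/andP; split; last first.
  rewrite leqNgt; apply/negP => mn.
  by rewrite (alternating_gt_dim _ (hO 0 I) mn) eqxx in e0.
rewrite -en; apply: spanned_leq => v.
set u := top_solve (Omega 0) (fun t => - Omega 0 (v :: t)) e.
(* At the centre, [u] and [v] have the same pairing with every [n]-element part of [e]; once [v = u]
   is known, [v] lies in the span of [e]. *)
have ue : spanned e u by exact: spanned_top_solve.
suff : v - u = 0 by move/eqP; rewrite subr_eq0 => /eqP ->.
set x := v - u; have x0 s : subseq s e -> size s = n -> forall y, Omega y (x :: s) = 0.
  move=> se sn y; apply: Omega_ray; rewrite /x (altD (hO 0 I) [::]) -scaleN1r.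
  by rewrite (altZ (hO 0 I) [::]) /= (top_solve_subseq _ (hO 0 I))// opprK mulN1r subrr.
apply/eqP; apply: contraT => /conformal_factor_ray/(_ e0); case=> y.
(* In [d Omega (x, e) = 0], all terms but the derivative of [Omega e] along [x] differentiate some
   [Omega (x, t)] with [t] an [n]-element part of [e], which is identically 0. *)
have := Omega_closed y (x :: e); rewrite /dflat /= => /eqP.
rewrite asum_eq0 ?subr0 => [/eqP//|a t te et].
have -> : (fun z => Omega z (x :: t)) = fun=> 0.
  by apply/funext => z; apply: x0 => //; move: et; rewrite en => -[].
exact: derive_cst.
Qed.

End Liouville.

(** * Hamiltonian forms in top degree *)

Section LinearFunctions.
Context {R : realType} {m : nat}.
Context (L : 'rV[R]_m -> R) (hL : forall a u v, L (a *: u + v) = a * L u + L v).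

Let L_expand z : L z = \sum_(i <- index_enum 'I_m) L (delta_mx 0 i) * z 0 i.
Proof.
have L0 : L 0 = 0 by have := hL (-1) 0 0; rewrite scaler0 addr0 mulN1r addNr.
rewrite {1}(row_sum_delta z); elim/big_rec2: _ => [//|i y1 y2 _ <-].
by rewrite hL mulrC.
Qed.

Let smooth_coord i : smooth setT (fun z : 'rV[R]_m => z 0 i).
Proof. exact: (smooth_coordP id openT).1 (@smooth_id _ _ setT) i. Qed.

Lemma smooth_linear : smooth setT L.
Proof.
have h : smooth setT (fun z : 'rV[R]_m => \sum_(i <- index_enum 'I_m) L (delta_mx 0 i) * z 0 i).
  apply: (smooth_sum _ openT) => i.
  by apply: (smoothM openT); [exact: smooth_cst|exact: smooth_coord].
by apply: smooth_eq openT _ h => z _; rewrite -L_expand.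
Qed.

Lemma derive_linear y v : 'D_v L y = L v.
Proof.
rewrite [RHS]L_expand.
rewrite (near_eq_derive (g := fun z : 'rV[R]_m =>
  \sum_(i <- index_enum 'I_m) L (delta_mx 0 i) * z 0 i)).
  rewrite derive_sumr => [|i].
    apply: eq_bigr => i _; rewrite -[in RHS](@derive_id R 'rV[R]_m y v).
    rewrite (derive_mx (@derivable_id R 'rV[R]_m y v)) mxE.
    refine (@deriveMl _ _ _ _ _ _ _).
    exact (smooth_derivable (smooth_coord i) I).
  exact (smooth_derivable (smoothM openT (smooth_cst _ _) (smooth_coord i)) I).
by apply: (open_near openT (I : setT y)) => z _; exact: L_expand.
Qed.

End LinearFunctions.

Section TopDegreeForms.
Context {R : realType} {m n : nat} {M : manifold R m} {w : diff_form M}.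
Hypotheses (hw : n_plectic n w) (mn : m = n.+1).

Let hwf : is_form n.+1 w. Proof. by have [] := hw. Qed.
Let e : seq 'rV[R]_m := std_basis.
Let en : size e = n.+1. Proof. by rewrite size_std_basis. Qed.

Lemma form_loc_nondegenerate p y v : chart_im p y ->
  (forall s, form_loc p w y (v :: s) = 0) -> v = 0.
Proof.
move=> py h; have [_ _ nd] := hw.
have v0 : diff_in (param p) y v = 0.
  apply: (nd (param p y)) => s.
  have := h [seq diff_out (chart p) (param p y) u | u <- s]; rewrite /form_loc /=.
  have -> // : [seq diff_in (param p) y u |
      u <- [seq diff_out (chart p) (param p y) u | u <- s]] = s.
  by elim: s => //= a s ->; rewrite -[X in diff_in _ X](paramK py) (diff_inK _ (param_dom py)).
by rewrite -(diff_outK v py) v0 /diff_out linear0.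
Qed.

Lemma form_loc_top_neq0 p y : chart_im p y -> form_loc p w y e != 0.
Proof.
move=> py; have h := (flat_form_loc p hwf).1 y py.
apply: (top_neq0 h (@spanned_std_basis _ _) en); apply: contrapT => h0.
have m_gt0 : (0 < m)%N by rewrite mn.
have /rowP/(_ (Ordinal m_gt0)) : const_mx 1 = 0 :> 'rV[R]_m.
  apply: (form_loc_nondegenerate py) => s; apply: contrapT => /eqP ws.
  by apply: h0; exists (const_mx 1 :: s).
by rewrite !mxE => /eqP; rewrite oner_eq0.
Qed.

Lemma top_neq0_std p : w p e != 0.
Proof.
have := form_loc_top_neq0 (chart_im_center p).
rewrite /form_loc param_center (_ : map _ _ = e)//.
by elim: e => //= a s ->; rewrite diff_in_center.
Qed.

Lemma top_hamiltonian b : (0 < n)%N -> is_form n.-1 b -> hamiltonian n w b.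
Proof.
move=> n0 hb; split=> //; have hdb := is_form_ext_deriv hb; rewrite prednK// in hdb.
pose u : vfield M := fun q => top_solve (w q) (ext_deriv b q) e.
have dbE : ext_deriv b = - interior_prod u w.
  apply/funext => q; apply/funext => s.
  exact: (top_solveP s (is_form_alternating q hwf) (is_form_alternating q hdb)
    (@spanned_std_basis _ _) en (top_neq0_std q)).
exists u; split=> // p; have op := open_chart_im p.
have W0 y : chart_im p y -> form_loc p w y e != 0 by exact: form_loc_top_neq0.
(* [u] was solved at each point in that point's own chart. Uniqueness of the solution identifies its
   components in the chart at [p] with Cramer's formula there, which is smooth. *)
have E y : chart_im p y ->
    top_solve (form_loc p w y) (form_loc p (ext_deriv b) y) e = vf_loc p u y.
  move=> py; apply/eqP; rewrite -subr_eq0; apply/eqP.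
  apply: (form_loc_nondegenerate py) => s.
  have hW := (flat_form_loc p hwf).1 y py; have hB := (flat_form_loc p hdb).1 y py.
  rewrite (altD hW [::]) -scaleN1r (altZ hW [::]) /= -(form_loc_interior u w s py).
  have := top_solveP s hW hB (@spanned_std_basis _ _) en (W0 y py).
  have -> : form_loc p (ext_deriv b) y s = - form_loc p (interior_prod u w) y s.
    by rewrite /form_loc dbE.
  by move/oppr_inj ->; rewrite mulN1r subrr.
apply: (smooth_eq op E); apply: (smooth_asum _ op) => v t.
apply: (smoothZl _ op); apply: (smoothN op); apply: (smoothM op).
  exact: (flat_form_loc p hdb).2.
exact: (smoothV op W0 ((flat_form_loc p hwf).2 e)).
Qed.

Lemma ham_vfP b : hamiltonian n w b -> is_ham_vf w b (ham_vf w b).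
Proof.
move=> [_ [u hu]]; exact: (xgetPex (fun=> 0) (ex_intro [set u | is_ham_vf w b u] u hu)).
Qed.

Section Spanning.
Context (p c : M) (K : set M) (f : M -> R).
Hypotheses (pc : chart_dom p c) (cK : closed K) (Kp : K `<=` chart_dom p).
Hypotheses (hf : smooth_out setT f) (fK : forall q, ~ K q -> f q = 0).
Hypotheses (fc : f c != 0) (n0 : (0 < n)%N).

Let W := form_loc p w (chart p c).
Let hW : alternating n.-1.+2 W.
Proof. by rewrite prednK//; exact: (flat_form_loc p hwf).1 (chart_im_chart pc). Qed.

Let beta v (z : 'rV[R]_m) (s : seq 'rV[R]_m) : R := W (v :: (z - chart p c) :: s).

Let flat_beta v : flat_form n.-1 setT (beta v).
Proof.
split=> [z _|s]; first exact: (alt_cons (z - chart p c) (alt_cons v hW)).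
have lin : forall a u u', W (v :: (a *: u + u') :: s) = a * W (v :: u :: s) + W (v :: u' :: s).
  by move=> *; exact: (alt_lin hW [:: v]).
apply: (smooth_eq openT (f := fun z => W (v :: z :: s) + - W (v :: chart p c :: s))).
  move=> z _; rewrite /beta (altD hW [:: v]) -[- chart p c]scaleN1r (altZ hW [:: v]).
  by rewrite mulN1r.
apply: (smoothD openT); last exact: smooth_cst.
exact: smooth_linear lin.
Qed.

(* [b = f . beta] is supported in the domain of [chart p], and [beta] vanishes at
   [c] with [d beta = n W(v, _)] there. *)
Let b v : diff_form M := fun q s =>
  f q * beta v (chart p q) [seq diff_out (chart p) q u | u <- s].

Let is_form_b v : is_form n.-1 (b v).
Proof.
have h q : alternating n.-1 (b v q).
  have [h1 h2 h3] : alternating n.-1 (fun s =>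
      beta v (chart p q) [seq diff_out (chart p) q u | u <- s]).
    apply: alternating_comp_linear; last exact: (flat_beta v).1 I.
    by move=> a u u'; rewrite /diff_out linearP.
  split=> *; first by rewrite /b h1// mulr0.
    by rewrite /b h2; ring.
  by rewrite /b h3 mulr0.
split.
- by move=> q; have [] := h q.
- by move=> q; have [] := h q.
- by move=> q; have [] := h q.
move=> q s; apply: smooth_local => y qy; have hq := smooth_on_param q.
(* Off the closed set [K], the factor [f] kills the arbitrary values of [chart p]; a point of [K]
   has a neighbourhood on which [chart p] is a genuine chart. *)
have [Ky|nKy] := pselect (K (param q y)); last first.
  have oA : open (~` K) by exact: closed_openC.
  exists [set z | chart_im q z /\ (~` K) (param q z)] => //.
  apply: (smooth_eq (open_smooth_on hq oA) (f := fun=> 0)); last exact: smooth_cst.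
  by move=> z [_ nK]; rewrite /form_loc /b fK// mul0r.
have oB := open_smooth_on hq (chart_dom_open p).
exists [set z | chart_im q z /\ chart_dom p (param q z)]; first by split=> //; exact: Kp.
have [_ _ hs] := hq.
apply: (smooth_eq oB (f := fun z => f (param q z) *
    flat_pull (chart p \o param q) (beta v) z s)).
  move=> z [qz pz]; rewrite /form_loc /b /flat_pull /=; congr (_ * beta _ _ _).
  refine (etrans _ (map_comp _ _ _)); apply: eq_map => u /=.
  exact (esym (diff_out_diff_in u qz pz)).
apply: (smoothM oB).
  apply: smooth_sub (smooth_out_comp openT hf hq _) => [z []//|//].
exact: (flat_form_pull oB (fun _ _ => I) (hs p) (flat_beta v)).2.
Qed.

Lemma ham_vf_spanning v : exists b, hamiltonian n w b /\ ham_vf w b c = v.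
Proof.
(* At [c] the term in [df] disappears because [beta] vanishes there, so [d b = f(c) n W(v', _)] and
   the Hamiltonian vector is [- f(c) n v']. *)
pose v' := - (f c * n%:R)^-1 *: diff_out (chart p) c v.
exists (b v'); have hb := top_hamiltonian n0 (is_form_b v'); split=> //.
have [_ dbE] := ham_vfP hb; set u := ham_vf w (b v') in dbE *.
have pcc := chart_im_chart pc; have op := open_chart_im p.
have key s : form_loc p (ext_deriv (b v')) (chart p c) s = f c * n%:R * W (v' :: s).
  rewrite (form_loc_ext_deriv _ (is_form_b v') pcc).
  rewrite (eq_dflat s op pcc (b' := fun z t => f (param p z) * beta v' z t)); last first.
    move=> z t pz; rewrite /form_loc /b (paramK pz); congr (_ * beta _ _ _).
    by elim: t => //= a t ->; rewrite (diff_outK _ pz).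
  have [ns|/negP ns] := boolP (size s == n); last first.
    rewrite (alt_size hW) ?mulr0; last by rewrite /= prednK// eqSS; apply/negP.
    apply: asum_eq0 => x t ts st.
    rewrite (near_eq_derive (g := fun=> 0)); first exact: derive_cst.
    apply: (open_near openT (I : setT (chart p c))) => z _.
    rewrite (alt_size ((flat_beta v').1 z I)) ?mulr0//.
    by apply: contra_not_neq ns => tn; rewrite st tn prednK.
  transitivity (asum (fun x t => f c * W (v' :: x :: t)) s); last first.
    rewrite asumZ (asum_cons s (alt_cons v' hW)) (eqP ns); ring.
  apply: eq_asum => x t _ _.
  have s1 : smooth (chart_im p) (fun z => f (param p z)).
    exact: (smooth_out_comp openT hf (smooth_on_param p)).
  have s2 : smooth setT (fun z => beta v' z t) := (flat_beta v').2 t.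
  rewrite (deriveM (smooth_derivable s1 pcc) (smooth_derivable s2 I)).
  have -> : beta v' (chart p c) t = 0 by rewrite /beta subrr; exact: (alt0 hW [:: v']).
  rewrite scale0r addr0 (chartK pc); congr (_ * _).
  rewrite (near_eq_derive (g := fun z =>
      W (v' :: z :: t) + - W (v' :: chart p c :: t))); last first.
    apply: (open_near openT (I : setT (chart p c))) => z _.
    rewrite /beta (altD hW [:: v']) -[- chart p c]scaleN1r (altZ hW [:: v']).
    by rewrite mulN1r.
  have lin : forall a u u', W (v' :: (a *: u + u') :: t) = a * W (v' :: u :: t) + W (v' :: u' :: t).
    by move=> *; exact: (alt_lin hW [:: v']).
  rewrite (deriveD (smooth_derivable (smooth_linear lin) I) (derivable_cst _ _ _)).
  by rewrite derive_cst addr0 (derive_linear lin).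
have uE : vf_loc p u (chart p c) = diff_out (chart p) c v.
  apply/eqP; rewrite -subr_eq0; apply/eqP; apply: (form_loc_nondegenerate pcc) => s.
  set x := diff_out (chart p) c v.
  change (W (vf_loc p u (chart p c) - x :: s) = 0).
  rewrite (altD hW [::]) -[- x]scaleN1r (altZ hW [::]) /= mulN1r.
  rewrite -[W (vf_loc _ _ _ :: s)](form_loc_interior u w s pcc).
  have -> : form_loc p (interior_prod u w) (chart p c) s =
      - form_loc p (ext_deriv (b v')) (chart p c) s.
    by rewrite /form_loc dbE; exact: (esym (opprK _)).
  rewrite key /v' (altZ hW [::]) /=; field.
  by rewrite fc pnatr_eq0 -lt0n n0.
rewrite -(diff_inK v pc) -uE /vf_loc (chartK pc).
by rewrite (diff_inK _ pc).
Qed.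

End Spanning.
End TopDegreeForms.

Section HomogeneousPlectic.
Context {R : realType} {m n : nat} {M : manifold R m} {w : diff_form M}.
Hypotheses (n_gt0 : (0 < n)%N) (hw : n_plectic n w) (hlh : locally_homogeneous w).
Hypotheses (m_gt0 : (0 < m)%N).

Lemma dense_ham_vf (p : M) (O : set M) : open O -> O p ->
  m = n.+1 /\
  exists2 c, O c & forall v, exists b, hamiltonian n w b /\ ham_vf w b c = v.
Proof.
(* The intersection puts [K] inside a single chart, as the cut-off construction requires; the point
   sought is the centre [psi 0]. *)
move=> oO Op; have oU : open (O `&` chart_dom p) by exact: openI oO (chart_dom_open p).
have [K [D [f [KU [cK _ hD DK [phi [psi [phiK psiK hphi hpsi heuler]]]] hf Lf]]]] :=
  hlh oU (conj Op (chart_dom_mem p)).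
have mn := liouville_dim hw m_gt0 cK hD DK hf Lf phiK psiK hphi hpsi heuler.
have fc := conformal_factor_center hw m_gt0 hD Lf phiK psiK hphi hpsi heuler.
have Kc : K (psi 0) by apply: DK; have [i0 _] := psiK 0; exact: interior_subset i0.
have [Oc pc] := KU _ Kc; split=> //; exists (psi 0) => // v.
have clK : closed K by exact: compact_closed (@manifold_hausdorff _ _ M) cK.
have fK q : ~ K q -> f q = 0.
  by move=> nK; apply: (conformal_factor_out hw m_gt0 Lf) => /DK.
have f0 : f (psi 0) != 0 by rewrite fc pnatr_eq0.
apply: (ham_vf_spanning hw mn pc clK _ hf fK f0 n_gt0).
by move=> q /KU[].
Qed.

End HomogeneousPlectic.

(** * The binary bracket, and comparison of forms on a dense set *)

Lemma ham_bracket2E (R : realType) (m : nat) (M : manifold R m) (w : diff_form M) b1 b2 p s :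
  ham_bracket w [:: (0, b1); (0, b2)] p s = w p [:: ham_vf w b1 p, ham_vf w b2 p & s].
Proof.
rewrite /ham_bracket /=.
change (xi 2 * w p [:: ham_vf w b1 p, ham_vf w b2 p & s] =
  w p [:: ham_vf w b1 p, ham_vf w b2 p & s]).
by rewrite /xi /= !exprS expr0; ring.
Qed.

Lemma hamiltonian_bracket (R : realType) (m n : nat) (M : manifold R m)
    (w : diff_form M) b1 b2 :
  (0 < n)%N -> n_plectic n w -> m = n.+1 -> hamiltonian n w b1 -> hamiltonian n w b2 ->
  hamiltonian n w (ham_bracket w [:: (0, b1); (0, b2)]).
Proof.
move=> n0 hw mn h1 h2; apply: top_hamiltonian => //.
have -> : ham_bracket w [:: (0, b1); (0, b2)] =
    interior_prod (ham_vf w b2) (interior_prod (ham_vf w b1) w).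
  by apply/funext => p; apply/funext => s; rewrite ham_bracket2E.
have [u1 _] := ham_vfP h1; have [u2 _] := ham_vfP h2; have [wf _ _] := hw.
apply: is_form_interior => //; apply: is_form_interior => //.
by rewrite prednK.
Qed.

(** A nonzero difference at [p], read in the fixed chart at [p], stays nonzero on a neighbourhood,
    which contains a point of agreement. *)
Lemma form_ext (R : realType) (m k : nat) (M : manifold R m) (a a' : diff_form M) :
  is_form k a -> is_form k a' ->
  (forall (p : M) O, open O -> O p -> exists2 q, O q & a q = a' q) -> a = a'.
Proof.
move=> ha ha' dense; apply/funext => p; apply/funext => s; apply: contrapT => /eqP as0.
have op := open_chart_im p; have hp := chart_im_center p.
have hs : smooth (chart_im p) (fun y => form_loc p a y s + - form_loc p a' y s).
  apply: (smoothD op); first exact: (flat_form_loc p ha).2.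
  by apply: (smoothN op); exact: (flat_form_loc p ha').2.
have c1 := smooth_continuous hs hp.
have c2 := @continuous_comp _ _ _ (chart p)
  (fun y => form_loc p a y s + - form_loc p a' y s) p
  (chart_continuous (chart_dom_mem p)) c1.
have locE (b : diff_form M) : form_loc p b (chart p p) s = b p s.
  rewrite /form_loc param_center; congr (b p _).
  by elim: s {as0 hs c1 c2} => //= v s ->; rewrite diff_in_center.
have ne : form_loc p a (chart p p) s + - form_loc p a' (chart p p) s != 0.
  by rewrite !locE subr_eq0.
have N : nbhs p [set q | form_loc p a (chart p q) s + - form_loc p a' (chart p q) s != 0].
  exact: (c2 _ (open_neq ne)).
have N' : nbhs p (chart_dom p) by exact: open_nbhs_nbhs (conj (chart_dom_open p) (chart_dom_mem p)).
have [q Oq aq] := dense p _ (open_interior _) (filterI N N').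
have [/= nq qp] := interior_subset Oq.
by move: nq; rewrite /form_loc (chartK qp) aq subrr eqxx.
Qed.

(** * Consequences of the morphism identities *)

Section StrictIsomorphism.
Context {R : realType} {n m1 m2 : nat} {M1 : manifold R m1} {M2 : manifold R m2}.
Context {w1 : diff_form M1} {w2 : diff_form M2} {F : M1 -> M2} {G : M2 -> M1}.
Context {phi : int -> diff_form M2 -> diff_form M1}.
Hypotheses (n_gt0 : (0 < n)%N) (hw1 : n_plectic n w1) (hw2 : n_plectic n w2).
Hypotheses (hF : smooth_map F) (hG : smooth_map G) (FK : cancel F G).
Hypothesis GK : cancel G F.
Hypothesis hphi : @strict_morphism R (lie_n_algebra n w2) (lie_n_algebra n w1) phi.
Hypothesis phiE : forall i : int, 1 - n%:Z <= i <= 0 ->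
  forall b, ham_comp n w2 i b -> phi i b = pullback F b.
Hypothesis bracket_ham : forall b1 b2, hamiltonian n w2 b1 -> hamiltonian n w2 b2 ->
  hamiltonian n w2 (ham_bracket w2 [:: (0, b1); (0, b2)]).

Let phi0 b : hamiltonian n w2 b -> phi 0 b = pullback F b.
Proof. by move=> hb; apply: phiE => //; rewrite lexx andbT subr_le0 lez_nat. Qed.

Let pushforwardFK p x : Defs.pushforward F p (Defs.pushforward G (F p) x) = x.
Proof. by have := pushforwardK (F p) x hG hF GK; rewrite FK. Qed.

Lemma hamiltonian_pullback b : hamiltonian n w2 b -> hamiltonian n w1 (pullback F b).
Proof. by move=> hb; rewrite -phi0//; have [h _ _] := hphi; exact: (h 0 b hb). Qed.

Lemma ham_vf_pullback b p s : hamiltonian n w2 b ->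
  w1 p (ham_vf w1 (pullback F b) p :: s) =
  w2 (F p) (ham_vf w2 b (F p) :: [seq Defs.pushforward F p v | v <- s]).
Proof.
move=> hb; have [_ E1] := ham_vfP (hamiltonian_pullback hb); have [_ E2] := ham_vfP hb.
have := ext_deriv_pullback hF hb.1; rewrite E1 => /(congr1 (fun a : diff_form M1 => a p s)).
by rewrite /pullback E2 => /oppr_inj.
Qed.

Lemma ham_bracket_pullback b1 b2 : hamiltonian n w2 b1 -> hamiltonian n w2 b2 ->
  ham_bracket w1 [:: (0, pullback F b1); (0, pullback F b2)] =
  pullback F (ham_bracket w2 [:: (0, b1); (0, b2)]).
Proof.
move=> h1 h2; have [_ _ h] := hphi.
have hom : homogeneous (L := lie_n_algebra n w2) [:: (0, b1); (0, b2)].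
  by move=> b; rewrite !inE => /orP[]/eqP ->.
have := h [:: (0, b1); (0, b2)] isT hom.
(* The binary bracket has degree 0, so [phi] acts on its value in degree 0, as a pullback. *)
have -> : \sum_(b <- [:: (0, b1); (0, b2)]) b.1 + 2 - (size [:: (0 : int, b1); (0, b2)])%:Z = 0.
  by rewrite !big_cons big_nil.
rewrite phi0; last exact: bracket_ham.
by rewrite /= !phi0.
Qed.

Lemma bracket_pullback b1 b2 p s : hamiltonian n w2 b1 -> hamiltonian n w2 b2 ->
  w1 p [:: ham_vf w1 (pullback F b1) p, ham_vf w1 (pullback F b2) p & s] =
  w2 (F p) [:: ham_vf w2 b1 (F p), ham_vf w2 b2 (F p) &
    [seq Defs.pushforward F p v | v <- s]].
Proof.
move=> h1 h2.
have := congr1 (fun a : diff_form M1 => a p s) (ham_bracket_pullback h1 h2).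
by rewrite /pullback !ham_bracket2E.
Qed.

(* Where the Hamiltonian vector fields span, the identity for [d] and that for
   the binary bracket show that [F] matches them. *)
Lemma pullback_eq_at p s :
  (forall v, exists b, hamiltonian n w2 b /\ ham_vf w2 b (F p) = v) ->
  pullback F w2 p s = w1 p s.
Proof.
move=> span; have [hf1 _ _] := hw1; have [hf2 _ nd2] := hw2.
have a2 := is_form_alternating (F p) hf2.
case: s => [|v s].
  by rewrite /pullback (alt_size (is_form_alternating p hf1))// (alt_size a2).
have [b [hb bE]] := span (Defs.pushforward F p v).
set u' := ham_vf w1 (pullback F b) p.
suff u'E : u' = v.
  by rewrite -[in RHS]u'E /u' ham_vf_pullback// bE.
rewrite -[LHS](pushforwardK p _ hF hG FK) -[RHS](pushforwardK p _ hF hG FK).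
congr (Defs.pushforward G _ _); apply/eqP; rewrite -subr_eq0; apply/eqP.
rewrite -bE; apply: (nd2 (F p)) => -[|a t].
  (* A single argument is too few for an [(n+1)]-form, as [n > 0]. *)
  by rewrite (alt_size a2)//= eqSS eq_sym -lt0n.
have [b1 [hb1 <-]] := span a.
have -> : t = [seq Defs.pushforward F p x | x <- [seq Defs.pushforward G (F p) x | x <- t]].
  elim: t => //= x t <-; congr cons; exact: esym (pushforwardFK p x).
(* With the vector of [b1] in front, the identity for [d b1], applied to [u' :: t'], and the bracket
   identity give both summands the same value up to sign. *)
set t' := map _ t; rewrite (alt_swap a2 [::]) /=.
rewrite (altD a2 [:: _]) -[- ham_vf _ _ _]scaleN1r (altZ a2 [:: _]) /=.
rewrite -(bracket_pullback p t' hb1 hb) -(ham_vf_pullback p (u' :: t') hb1).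
by rewrite mulN1r subrr oppr0.
Qed.

End StrictIsomorphism.

Theorem theorem4p2p9 (R : realType) (n m1 m2 : nat)
  (M1 : manifold R m1) (M2 : manifold R m2) (w1 : diff_form M1) (w2 : diff_form M2)
  (phi : int -> diff_form M2 -> diff_form M1) (F : M1 -> M2) :
  (1 <= n)%N ->
  n_plectic n w1 -> n_plectic n w2 ->
  locally_homogeneous w1 -> locally_homogeneous w2 ->
  diffeomorphism F ->
  @strict_isomorphism R (lie_n_algebra n w2) (lie_n_algebra n w1) phi ->
  (forall i : int, 1 - n%:Z <= i <= 0 ->
     forall b, ham_comp n w2 i b -> phi i b = pullback F b) ->
  pullback F w2 = w1.
Proof.
move=> n0 hw1 hw2 _ lh2 [hF [G [hG FK GK]]] [hphi _] phiE.
have [hf1 _ _] := hw1; have [hf2 _ _] := hw2.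
have hFw := is_form_pullback hF hf2.
apply: (form_ext hFw hf1) => p O oO Op.
(* In dimension 0 non-degeneracy is vacuous and does not make [w2] nonzero; but then [M1] has
   dimension 0 too, and forms of positive degree vanish. *)
have [m2_0|m2_gt0] := posnP m2.
  exists p => //; have m1_0 : m1 = 0%N.
    apply/eqP; rewrite -leqn0 leqNgt; apply/negP => m1_gt0.
    have v0 : forall v : 'rV[R]_m1, v = 0.
      move=> v; rewrite -(pushforwardK p v hF hG FK).
      suff -> : Defs.pushforward F p v = 0 by rewrite /Defs.pushforward /diff_out linear0.
      by apply/rowP => i; have := ltn_ord i; rewrite {2}m2_0.
    have /rowP/(_ (Ordinal m1_gt0)) := v0 (const_mx 1).
    by rewrite !mxE => /eqP; rewrite oner_eq0.
  apply/funext => s; have lt1 : (m1 < n.+1)%N by rewrite m1_0.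
  by rewrite !(alternating_gt_dim _ (is_form_alternating p _) lt1).
(* A centre [c] is sought in the image of [O] under [F]; the point of [O] above it is [G c]. *)
have cG := hG.1; have oU : open (G @^-1` O) by apply: open_comp => // q _; exact: cG.
have UFp : (G @^-1` O) (F p) by rewrite /= FK.
have [mn [c Oc span]] := dense_ham_vf n0 hw2 lh2 m2_gt0 oU UFp.
exists (G c) => //; apply/funext => s.
apply: (pullback_eq_at n0 hw1 hw2 hF hG FK GK hphi phiE) => [b1 b2 h1 h2|v].
  exact: (hamiltonian_bracket n0 hw2 mn).
by have := span v; rewrite GK.
Qed.
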